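(* Let $\psi$ be a bounded complexity measure and let $A$ be a nonempty closed class of decision tables from $\mathcal{M}_k^2$. Then $F^W_{\psi,A}$ and $F^\Theta_{\psi,A}$ are nondecreasing functions, and: (a) if the functions $S_\psi$ and $N$ are bounded from above on $A$, then there is a constant $c_0\ge 0$ such that $F^W_{\psi,A}(n)\le F^\Theta_{\psi,A}(n)\le c_0$ for all $n\in\omega$; (b) if $S_\psi$ is bounded from above on $A$ and $N$ is not bounded from above on $A$, then $F^W_{\psi,A}(0)=F^\Theta_{\psi,A}(0)=0$ and there are positive constants $c_1,c_2,c_3,c_4$ such that $c_1\log_2 n-c_2\le F^W_{\psi,A}(n)\le F^\Theta_{\psi,A}(n)\le c_3\log_2 n+c_4$ for all $n\in\omega\setminus\{0\}$; (c) if $S_\psi$ is not bounded from above on $A$, then there is an infinite set $D\subseteq\omega$ such that $H_D(n)\le F^W_{\psi,A}(n)\le F^\Theta_{\psi,A}(n)\le n$ for all $n\in\omega$.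
   Context: Fix an integer $k\ge 2$; $\omega=\{0,1,2,\ldots\}$, $E_k=\{0,1,\ldots,k-1\}$, $E_2=\{0,1\}$. Let $P=\{f_i:i\in\omega\}$ be a set of attribute names ($f_i\ne f_j$ for $i\ne j$). $\mathcal{M}_k^2$ is the set of rectangular tables filled with numbers from $E_k$ whose columns are labeled with pairwise different attributes from $P$, whose rows are pairwise different, and in which each row is labeled with a decision from $E_2$; rows are viewed as tuples of values of the column attributes. Tables without rows also belong to $\mathcal{M}_k^2$ and are all denoted $\Lambda$. Tables differing only by a permutation of rows (with their decisions) are equal. $P(T)$ is the set of attributes labeling the columns of $T$. $\mathcal{M}_k^2\mathcal{C}$ is the set of tables of $\mathcal{M}_k^2$ in which all rows have the same decision ($\Lambda\in\mathcal{M}_k^2\mathcal{C}$). For $f_{i_1},\ldots,f_{i_m}\in P(T)$ and $\delta_1,\ldots,\delta_m\in E_k$, $T(f_{i_1},\delta_1)\cdots(f_{i_m},\delta_m)$ is obtained from $T$ by removing all rows that do not have values $\delta_1,\ldots,\delta_m$ in the columns labeled $f_{i_1},\ldots,f_{i_m}$ respectively. $N(T)$ is the number of rows of $T$. Operations: for $D\subseteq P(T)$, $I(D,T)$ is obtained by deleting the columns labeled by attributes in $D$ and, in each group of rows coinciding on the remaining columns, keeping only one row, with the minimum decision; $I(\emptyset,T)=T$, $I(P(T),T)=\Lambda$. For $\nu:E_k^{|P(T)|}\to E_2$ ($E_k^0=\emptyset$), $J(\nu,T)$ is obtained by replacing the decision of each row $\bar\delta$ by $\nu(\bar\delta)$.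 $[T]=\{J(\nu,I(D,T)):D\subseteq P(T),\ \nu:E_k^{|P(T)\setminus D|}\to E_2\}$; for nonempty $A\subseteq\mathcal{M}_k^2$, $[A]=\bigcup_{T\in A}[T]$; $A$ is a closed class if $[A]=A$. A set $D\subseteq P(T)$ is a test of $T$ if any two rows of $T$ with different decisions differ in some column labeled with an attribute of $D$; for $T\in\mathcal{M}_k^2\mathcal{C}$ every subset of $P(T)$, including $\emptyset$, is a test. A $k$-decision tree is a finite directed rooted tree with at least two nodes in which the root and the edges leaving it are unlabeled, each terminal node (no leaving edges) is labeled with a decision from $E_2$, and each other node is labeled with an attribute from $P$, each edge leaving such a node being labeled with a number from $E_k$. $P(\Gamma)$ is the set of attributes labeling nodes of $\Gamma$. A complete path $\tau=v_1,d_1,\ldots,v_m,d_m,v_{m+1}$ goes from the root $v_1$ to a terminal node $v_{m+1}$; $F(\tau)$ is the empty word if $m=1$ and $f_{i_2}\cdots f_{i_m}$ otherwise, where $v_j$ is labeled $f_{i_j}$. If $P(\Gamma)\subseteq P(T)$, then $T(\tau)=T$ for $m=1$ and $T(\tau)=T(f_{i_2},\delta_2)\cdots(f_{i_m},\delta_m)$ otherwise, where $d_j$ is labeled $\delta_j$. For $T\ne\Lambda$, a deterministic decision tree for $T$ is a $k$-decision tree $\Gamma$ such that exactly one edge leaves the root, edges leaving any other nonterminal node have pairwise different labels, $P(\Gamma)\subseteq P(T)$, every row of $T$ belongs to $T(\tau)$ for some complete path $\tau$, and for every complete path $\tau$ either $T(\tau)=\Lambda$ or all rows of $T(\tau)$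 have the decision labeling the terminal node of $\tau$. For $T\notin\mathcal{M}_k^2\mathcal{C}$, a strongly nondeterministic decision tree for $T$ is a $k$-decision tree $\Gamma$ all of whose terminal nodes are labeled $1$, with $P(\Gamma)\subseteq P(T)$, such that every row of $T$ with decision $1$ belongs to $T(\tau)$ for some complete path $\tau$, and for every complete path $\tau$ either $T(\tau)=\Lambda$ or all rows of $T(\tau)$ have decision $1$. Let $B$ be the set of finite words over the alphabet $P$ (including the empty word $\lambda$). A complexity measure is a function $\psi:B\to\omega$ with: $\psi(\alpha)=0$ iff $\alpha=\lambda$; $\psi$ is invariant under permutation of letters; $\psi(\alpha_1)\le\psi(\alpha_1\alpha_2)$; $\psi(\alpha_1\alpha_2)\le\psi(\alpha_1)+\psi(\alpha_2)$. It is bounded if moreover $\psi(\alpha)\ge|\alpha|$ (word length). For a finite $D\subseteq P$, $\psi(\emptyset)=0$ and $\psi(\{f_{i_1},\ldots,f_{i_m}\})=\psi(f_{i_1}\cdots f_{i_m})$. For a $k$-decision tree, $\psi(\Gamma)=\max_\tau\psi(F(\tau))$ over complete paths. Parameters (all equal $0$ on $\Lambda$); for $T\ne\Lambda$: $\psi^d(T)$ is the minimum of $\psi(\Gamma)$ over deterministic decision trees for $T$; $\Theta_\psi(T)$ is the minimum of $\psi(D)$ over tests $D$ of $T$; $W_\psi(T)=\psi(P(T))$; for a row $\bar\delta$, $S_\psi(T,\bar\delta)$ is the minimum of $\psi(D)$ over $D\subseteq P(T)$ such that on the columns labeled by $D$ the row $\bar\delta$ differs from all other rows of $T$, and $S_\psi(T)=\max_{\bar\delta}S_\psi(T,\bar\delta)$.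 For bounded $\psi$, nonempty closed $A$ and $n\in\omega$: $F^W_{\psi,A}(n)=\max\{\psi^d(T):T\in A,W_\psi(T)\le n\}$ and $F^\Theta_{\psi,A}(n)=\max\{\psi^d(T):T\in A,\Theta_\psi(T)\le n\}$. For an infinite $D=\{n_i:i\in\omega\}\subseteq\omega$ with $n_i<n_{i+1}$, $H_D:\omega\to\omega$ is given by $H_D(n)=0$ if $n<n_0$ and $H_D(n)=n_i$ if $n_i\le n<n_{i+1}$. *)

(* Defs.v *)
From HB Require Import structures.
From mathcomp Require Import all_boot all_order all_algebra finmap.
From mathcomp Require Import boolp classical_sets cardinality reals exp.

Set Implicit Arguments.
Unset Strict Implicit.
Unset Printing Implicit Defensive.

Import Order.TTheory GRing.Theory Num.Theory.

Local Open Scope fset_scope.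
Local Open Scope fmap_scope.
Local Open Scope nat_scope.

(* The attribute f_i is represented by the number i, a word over the
   attributes by a [seq nat], E_k by ['I_k], and E_2 by [bool]
   (0 = false, 1 = true). *)

Section Tables.
Variable k : nat.

Definition row := seq 'I_k.

(* A table is the list of its column attributes and the finite map sending each
   row to its decision, so tables differing by a permutation of rows are equal.
   The last clause makes all tables without rows equal, with no columns, and
   excludes rows of length 0 (E_k^0 is empty by convention). *)
Definition table_wf (cd : seq nat * {fmap row -> bool}) : bool :=
  [&& uniq cd.1, all (fun r : row => size r == size cd.1) (domf cd.2)
    & (cd.1 == [::]) == (cd.2 == [fmap])].

Record table := Table {
  table_val : seq nat * {fmap row -> bool};
  table_valP : table_wf table_val }.

HB.instance Definition _ := [isSub for table_val].
HB.instance Definition _ := [Equality of table by <:].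

Definition cols (T : table) : seq nat := (table_val T).1.
Definition dec (T : table) : {fmap row -> bool} := (table_val T).2.
Definition rows (T : table) : {fset row} := domf (dec T).

Definition attrs (T : table) : {fset nat} := [fset a in cols T].
Definition nrows (T : table) : nat := #|` rows T|.

Fact Lambda_wf : table_wf ([::], [fmap]).
Proof. by rewrite /table_wf /= !eqxx. Qed.

Definition Lambda : table := Table Lambda_wf.

(* Where it is used below, [(c, d)] is ill-formed only if exactly one of the list
   of columns and the set of rows is empty, and then the result is Lambda (see
   [J_opE], [I_opE], [I_op_all] and [rows_restrict]). *)
Definition mk_table (c : seq nat) (d : {fmap row -> bool}) : table :=
  insubd Lambda (c, d).

(* The value of row [r] of [T] in column [a]; [None] iff there is no such
   column. *)
Definition cell (T : table) (r : row) (a : nat) : option 'I_k :=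
  onth r (index a (cols T)).

(* T(f_{i_1}, delta_1) ... (f_{i_m}, delta_m), for
   w = [:: (i_1, delta_1); ...; (i_m, delta_m)]. *)
Definition restrict (T : table) (w : seq (nat * 'I_k)) : table :=
  mk_table (cols T)
    (dec T).[& [fset r in rows T |
                 all (fun e => cell T r e.1 == Some e.2) w]].

Definition proj_row (D : {fset nat}) (c : seq nat) (r : row) : row :=
  mask [seq a \notin D | a <- c] r.

(* The decision of a row of [I(D,T)] is the minimum, i.e. the conjunction, of
   the decisions of the rows of [T] projecting onto it. *)
Definition I_rows (D : {fset nat}) (T : table) : {fmap row -> bool} :=
  [fmap r : [fset proj_row D (cols T) r' | r' in rows T] =>
     [forall r' : rows T,
        (proj_row D (cols T) (val r') == val r) ==> dec T r']].

Definition I_op (D : {fset nat}) (T : table) : table :=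
  mk_table [seq a <- cols T | a \notin D] (I_rows D T).

(* Only the values of [nu] on the words of length |P(T)| matter. *)
Definition J_op (nu : row -> bool) (T : table) : table :=
  mk_table (cols T) [fmap r : rows T => nu (val r)].

Definition table_closure (T : table) : set table :=
  [set T' | exists (D : {fset nat}) (nu : row -> bool),
     (D `<=` attrs T)%fset /\ T' = J_op nu (I_op D T)]%classic.

Definition class_closure (A : set table) : set table :=
  [set T' | exists T, A T /\ table_closure T T']%classic.

Definition closed_class (A : set table) : Prop := class_closure A = A.

Definition is_test (T : table) (D : {fset nat}) : Prop :=
  D `<=` attrs T /\
  forall r r' : rows T, dec T r != dec T r' ->
    exists2 a, a \in D & cell T (val r) a != cell T (val r') a.

Definition separates (T : table) (r : row) (D : {fset nat}) : Prop :=
  D `<=` attrs T /\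
  forall r', r' \in rows T -> r' != r ->
    exists2 a, a \in D & cell T r a != cell T r' a.

(* A [node] is the part of a tree hanging below a non-root node; a [Query] node
   has its leaving edges listed as a first edge and the other ones, so that it
   is never terminal. *)
Inductive node : Type :=
| Leaf of bool
| Query of nat & 'I_k * node & seq ('I_k * node).

(* The subtrees hanging from the edges leaving the root (there is at least one
   such edge). *)
Inductive dtree : Type := Root of node & seq node.

(* The complete paths, each given by its attribute/value pairs
   (f_{i_2}, delta_2), ..., (f_{i_m}, delta_m) and its terminal decision. *)
Fixpoint node_paths (v : node) : seq (seq (nat * 'I_k) * bool) :=
  match v with
  | Leaf d => [:: ([::], d)]
  | Query f e es =>
      let branch (e : 'I_k * node) :=
        [seq ((f, e.1) :: p.1, p.2) | p <- node_paths e.2] in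
      branch e ++ flatten [seq branch e' | e' <- es]
  end.

Definition paths (G : dtree) : seq (seq (nat * 'I_k) * bool) :=
  let: Root v vs := G in flatten [seq node_paths v' | v' <- v :: vs].

Fixpoint node_attrs (v : node) : seq nat :=
  match v with
  | Leaf _ => [::]
  | Query f e es =>
      f :: node_attrs e.2 ++ flatten [seq node_attrs e'.2 | e' <- es]
  end.

Definition dtree_attrs (G : dtree) : {fset nat} :=
  let: Root v vs := G in
  [fset a in flatten [seq node_attrs v' | v' <- v :: vs]].

Fixpoint node_deterministic (v : node) : bool :=
  match v with
  | Leaf _ => true
  | Query _ e es =>
      [&& uniq [seq e'.1 | e' <- e :: es], node_deterministic e.2
        & all (fun e' => node_deterministic e'.2) es]
  end.

Definition deterministic (G : dtree) : bool :=
  let: Root v vs := G in nilp vs && node_deterministic v.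

Definition det_tree_for (T : table) (G : dtree) : Prop :=
  [/\ deterministic G,
      dtree_attrs G `<=` attrs T,
      forall r, r \in rows T ->
        exists2 p, p \in paths G & r \in rows (restrict T p.1)
    & forall p, p \in paths G ->
        restrict T p.1 = Lambda \/
        forall r : rows (restrict T p.1), dec (restrict T p.1) r = p.2].

End Tables.

Arguments Lambda {k}.

Record complexity_measure (psi : seq nat -> nat) : Prop := {
  cm_eq0 : forall w, psi w = 0 <-> w = [::];
  cm_perm : forall w1 w2, perm_eq w1 w2 -> psi w1 = psi w2;
  cm_le_cat : forall w1 w2, psi w1 <= psi (w1 ++ w2);
  cm_cat_le : forall w1 w2, psi (w1 ++ w2) <= psi w1 + psi w2 }.

Definition bounded_measure (psi : seq nat -> nat) : Prop :=
  complexity_measure psi /\ forall w, size w <= psi w.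

(* Minimum and maximum of a set of natural numbers, with value 0 by convention
   when they do not exist. *)
Definition is_min (X : set nat) (m : nat) : Prop :=
  X m /\ forall x, X x -> m <= x.
Definition is_max (X : set nat) (m : nat) : Prop :=
  X m /\ forall x, X x -> x <= m.
Definition minN (X : set nat) : nat := xget 0 (is_min X).
Definition maxN (X : set nat) : nat := xget 0 (is_max X).

Section TableComplexity.
Variables (k : nat) (psi : seq nat -> nat).

(* [enum_fset D] is the word listing the elements of [D] once each. *)
Definition psi_set (D : {fset nat}) : nat := psi (enum_fset D).

Definition psi_tree (G : dtree k) : nat :=
  \max_(p <- paths G) psi [seq e.1 | e <- p.1].

Definition psid (T : table k) : nat :=
  if T == Lambda then 0
  else minN [set m | exists2 G, det_tree_for T G & m = psi_tree G]%classic.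

Definition Theta (T : table k) : nat :=
  if T == Lambda then 0
  else minN [set m | exists2 D, is_test T D & m = psi_set D]%classic.

Definition W (T : table k) : nat :=
  if T == Lambda then 0 else psi_set (attrs T).

Definition S_row (T : table k) (r : row k) : nat :=
  minN [set m | exists2 D, separates T r D & m = psi_set D]%classic.

Definition S_par (T : table k) : nat :=
  if T == Lambda then 0 else \max_(r : rows T) S_row T (val r).

Definition bounded_on (A : set (table k)) (g : table k -> nat) : Prop :=
  exists b, forall T, A T -> g T <= b.

Definition complexity_values (A : set (table k)) (g : table k -> nat) (n : nat)
  : set nat :=
  [set m | exists T, [/\ A T, g T <= n & m = psid T]]%classic.

Definition FW (A : set (table k)) (n : nat) : nat :=
  maxN (complexity_values A W n).

Definition FTheta (A : set (table k)) (n : nat) : nat :=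
  maxN (complexity_values A Theta n).

End TableComplexity.

(* [H] is the step function H_D, defined from the increasing enumeration of
   [D]; it is determined by [D]. *)
Definition is_step_function (D : set nat) (H : nat -> nat) : Prop :=
  exists d : nat -> nat,
    [/\ forall i, d i < d i.+1,
        D = [set d i | i in setT]%classic,
        forall n, n < d 0 -> H n = 0
      & forall i n, d i <= n < d i.+1 -> H n = d i].

Definition log2 (R : realType) (x : R) : R := (ln x / ln 2)%R.

Section Facts.
Variable k : nat.
Implicit Types (T : table k) (D : {fset nat}).

Lemma size_row T r : r \in rows T -> size r = size (cols T).
Proof.
move=> rT; case/and3P: (table_valP T) => _ /allP/(_ r rT)/eqP -> //.
Qed.

Lemma table_ext T T' : cols T = cols T' -> dec T = dec T' -> T = T'.
Proof.
by case: T => [[c d] w]; case: T' => [[c' d'] w'] /= ec ed; apply: val_inj => /=;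
   move: ec ed; rewrite /cols /dec /= => -> ->.
Qed.

Lemma Lambda_cols T : (T == Lambda) = (cols T == [::]).
Proof.
apply/eqP/eqP => [-> //|cT]; apply: table_ext => //.
by case/and3P: (table_valP T) => _ _; rewrite -/(cols T) cT eqxx => /eqP/esym/eqP.
Qed.

Lemma Lambda_rows T : (T == Lambda) = (rows T == fset0).
Proof.
rewrite Lambda_cols; case/and3P: (table_valP T) => _ _ /eqP ->.
apply/eqP/eqP => [/(congr1 (@domf _ _))//|e].
by apply/fmapP => r; rewrite !not_fnd // ?inE // -[domf _]/(rows T) e inE.
Qed.

Lemma mk_tableE (c : seq nat) (d : {fmap row k -> bool}) :
  uniq c -> (forall r, r \in domf d -> size r = size c) ->
  c != [::] -> d != [fmap] ->
  cols (mk_table c d) = c /\ dec (mk_table c d) = d.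
Proof.
move=> uc sz c0 d0; have wf : table_wf (c, d).
  rewrite /table_wf uc /= (negPf c0) (negPf d0) eqxx andbT.
  by apply/allP => r /sz/eqP.
by rewrite /cols /dec /mk_table -!/(val _) insubdK.
Qed.

Lemma J_opE (nu : row k -> bool) T :
  cols (J_op nu T) = cols T /\
  dec (J_op nu T) = [fmap r : rows T => nu (val r)].
Proof.
have [uc _ cd] := and3P (table_valP T).
rewrite /J_op /mk_table /cols /dec -!/(val _) insubdK //.
rewrite -topredE /= /table_wf /= uc /=; apply/andP; split.
  by apply/allP => r /= /size_row ->.
have := Lambda_rows T; rewrite Lambda_cols => ->; apply/eqP.
apply/eqP/eqP => [e|/(congr1 (@domf _ _))//].
by apply/fmapP => r; rewrite !not_fnd // ?inE //= e inE.
Qed.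

Lemma I_opE D T : ~~ (attrs T `<=` D) ->
  cols (I_op D T) = [seq a <- cols T | a \notin D] /\
  dec (I_op D T) = I_rows D T.
Proof.
have [uc _ _] := and3P (table_valP T) => /fsubsetPn[a aT aD].
have aT' : a \in cols T by move: aT; rewrite !inE.
apply: mk_tableE; first exact: filter_uniq.
- move=> _ /imfsetP[r /= rT ->]; rewrite /proj_row size_filter size_mask.
    by rewrite count_map.
  by rewrite size_map (size_row rT).
- by apply/eqP => e; have := mem_filter [pred x | x \notin D] a (cols T);
     rewrite /= aD aT' /= e.
apply/eqP => /(congr1 (@domf _ _)) /= /fsetP e.
have : rows T != fset0.
  by rewrite -Lambda_rows Lambda_cols; apply/eqP => e'; rewrite e' in aT'.
case/fset0Pn => r rT; have := e (proj_row D (cols T) r).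
by rewrite inE in_imfset.
Qed.

Lemma I_op_all T : I_op (attrs T) T = Lambda.
Proof.
apply/eqP; rewrite Lambda_cols; apply/eqP; rewrite /I_op /mk_table /insubd.
case: insubP => //= u _ e; rewrite /cols e /=.
by apply/eqP; rewrite -[_ == _]negbK -has_filter -all_predC; apply/allP => a aT /=;
   rewrite negbK !inE.
Qed.

Lemma I_op0 T : I_op fset0 T = T.
Proof.
have [T0|Tn0] := eqVneq (cols T) [::].
  have /eqP -> : T == Lambda by rewrite Lambda_cols T0.
  by rewrite -[RHS](I_op_all Lambda); congr I_op; apply/fsetP => a; rewrite !inE.
have nT : ~~ (attrs T `<=` fset0).
  rewrite fsubset0 /attrs; apply: contra_neq Tn0 => /fsetP e.
  by case: (cols T) e => // a s /(_ a); rewrite !inE eqxx.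
have idr r : r \in rows T -> proj_row fset0 (cols T) r = r.
  move=> rT; rewrite /proj_row (_ : map _ _ = nseq (size r) true) ?mask_true //.
  by rewrite (size_row rT); elim: (cols T) => //= a s ->.
have [ce de] := I_opE nT; apply: table_ext; rewrite ?ce ?de.
  by rewrite (eq_filter (a2 := predT)) ?filter_predT // => a; rewrite inE.
have dI : domf (I_rows fset0 T) = rows T.
  apply/fsetP => r; apply/imfsetP/idP => [[r' /= rT ->]|rT]; first by rewrite idr.
  by exists r; rewrite ?idr.
apply/fmapP => r; have [rT|rT] := boolP (r \in rows T); last first.
  by rewrite !not_fnd //; change (r \notin domf (I_rows fset0 T)); rewrite dI.
have rI : r \in domf (I_rows fset0 T) by rewrite dI.
rewrite (in_fnd rI) (in_fnd rT) ffunE; congr Some.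
apply/forallP/idP => [/(_ [` rT])|dr r'].
  by rewrite /= idr // eqxx.
apply/implyP => /eqP /=; rewrite idr ?(valP r') // => e.
by rewrite (_ : r' = [` rT]) //; apply: val_inj.
Qed.

Lemma rows_restrict T w r :
  (r \in rows (restrict T w)) =
  (r \in rows T) && all (fun e => cell T r e.1 == Some e.2) w.
Proof.
rewrite /restrict; set A := [fset r in _ | _]%fset; set d := (dec T).[& A].
have dE : domf d = A.
  rewrite domf_restrict; apply/fsetIidPl/fsubsetP => x.
  by rewrite !inE => /andP[].
have <- : (r \in A) = (r \in rows T) && all (fun e => cell T r e.1 == Some e.2) w.
  by rewrite !inE.
case: (d =P [fmap]) => [d0|/eqP d0].
  have A0 : A = fset0 by rewrite -dE d0.
  rewrite A0 inE /mk_table /insubd; case: insubP => [u /= _ e|] //=.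
  by rewrite /rows /dec -!/(val _) e d0.
have uc : uniq (cols T) by case/and3P: (table_valP T).
have sz x : x \in domf d -> size x = size (cols T).
  by rewrite dE !inE => /andP[/size_row].
have c0 : cols T != [::].
  rewrite -Lambda_cols Lambda_rows; apply: contra_neq d0 => T0.
  have A0 : A = fset0.
    by apply/fsetP => x; rewrite !inE T0 inE.
  apply/fmapP => x; rewrite fnd_fmap0; apply: not_fnd.
  by change (x \notin domf d); rewrite dE A0 inE.
by have [_ e] := mk_tableE uc sz c0 d0; rewrite /rows e dE.
Qed.

End Facts.

(* Main.v *)
Require Import Defs.
From mathcomp Require Import all_boot all_order all_algebra finmap.
From mathcomp Require Import boolp classical_sets cardinality reals exp.
From mathcomp Require Import zify.

(* Upper bounds.  Reading a cheapest test gives psi^d <= Theta <= W, and the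
   union of separating sets of all rows is a test, hence (a).  If S <= s on A,
   then for every tuple of column values occurring in T some set of cost at most
   2s isolates at most one row agreeing with it: for a tuple that is not a row,
   take a minimal set D on which no row agrees with it; in the projection to
   D \ {f} the tuple becomes a row with a neighbour differing in any prescribed
   single column, so D \ {f} costs at most s.  Reading such a set for the
   majority values halves the number of remaining rows, so psi^d is at most
   2s log2 N.  Projecting first to a cheapest test bounds N by (n k)^s.

   Lower bounds.  If N is unbounded, minimal sets of columns separating all rows
   yield in A tables with any number m of columns, each column f having a pair of
   rows differing in f only, and W <= m s.  Some labelling with two decisions
   separates all these pairs, so a tree must contain all m columns and has depth
   at least of order log m.  If S is unbounded, project to a minimal separating
   set of an expensive row and label only this row with 1: each tree reads all
   the columns on its path, so psi^d = W. *)

Set Implicit Arguments.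
Unset Strict Implicit.
Unset Printing Implicit Defensive.

Import Order.TTheory GRing.Theory Num.Theory.

(** * Extrema of sets of naturals and step functions *)

Section MinMax.
Local Open Scope nat_scope.

Lemma minN_min (X : set nat) x : X x -> is_min X (minN X).
Proof.
move=> Xx; have ex : exists n, `[< X n >] by exists x; apply/asboolP.
apply: xgetPex; case: (ex_minnP ex) => m /asboolP Xm lem.
by exists m; split=> // y Xy; apply: lem; apply/asboolP.
Qed.

Lemma minN_in (X : set nat) x : X x -> X (minN X).
Proof. by case/minN_min. Qed.

Lemma minN_le (X : set nat) x : X x -> minN X <= x.
Proof. by move=> Xx; case: (minN_min Xx) => _; apply. Qed.

Lemma maxN_max (X : set nat) x b :
  X x -> (forall y, X y -> y <= b) -> is_max X (maxN X).
Proof.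
move=> Xx leb; have ex : exists n, `[< X n >] by exists x; apply/asboolP.
have leb' i : `[< X i >] -> i <= b by move/asboolP/leb.
apply: xgetPex; case: (ex_maxnP ex leb') => m /asboolP Xm lem.
by exists m; split=> // y Xy; apply: lem; apply/asboolP.
Qed.

(** Serves the lower bound in (c): every nonzero value of [H] is a member of [X] not exceeding the
    argument, so a table witnessing that member bounds [FW] from below. *)
Lemma step_function_exists (X : set nat) :
  (forall b, exists2 n, X n & b < n) ->
  exists (D : set nat) (H : nat -> nat),
    [/\ infinite_set D, is_step_function D H, (D `<=` X)%classic
      & forall n, H n = 0 \/ D (H n) /\ H n <= n].
Proof.
move=> Xunb; have [next nextP] : {f : nat -> nat & forall b, X (f b) /\ b < f b}.
  by apply: (@boolp.choice _ _ (fun b n => X n /\ b < n)) => b; have [n] := Xunb b; exists n.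
(* The exponent [i.+1] instead of [i] puts already [d 0] in [X]. *)
pose d i := iter i.+1 next 0.
have dS i : d i < d i.+1 by rewrite [d i.+1]iterS; case: (nextP (d i)).
have d_lt : {homo d : i j / i < j} := homo_ltn ltn_trans dS.
have d_le i j : i <= j -> d i <= d j.
  by rewrite leq_eqVlt => /predU1P[->|/d_lt/ltnW].
have d_ge i : i <= d i by elim: i => // i /leq_ltn_trans; apply.
(* Since [i <= d i], only indices [i <= n] can satisfy [d i <= n], so a finite maximum suffices;
   below [d 0] it is empty and gives 0. *)
exists [set d i | i in setT]%classic, (fun n => \max_(i < n.+1 | d i <= n) d i).
split.
- have d_inj : {in setT &, injective d}.
    by move=> i j _ _ e; case: (ltngtP i j) => // /d_lt; rewrite e ltnn.
  by rewrite (eq_finite_set (inj_card_eq d_inj)); apply: infinite_nat.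
- exists d; split=> // [n ltn|i n /andP[lein ltni]].
    apply: big1 => i lei; have := leq_ltn_trans (d_le _ _ (leq0n i)) (leq_ltn_trans lei ltn).
    by rewrite ltnn.
  apply/eqP; rewrite eqn_leq; apply/andP; split.
    apply/bigmax_leqP => j lej; apply: (d_le); rewrite leqNgt; apply/negP => /d_le.
    by rewrite leqNgt (leq_ltn_trans lej ltni).
  have lti : i < n.+1 by rewrite ltnS (leq_trans (d_ge i)).
  exact: (@leq_bigmax_cond _ (fun j : 'I_n.+1 => d j <= n) (fun j => d j) (Ordinal lti)).
- by move=> _ [i _ <-]; rewrite /d iterS; case: (nextP (iter i next 0)).
- move=> n; elim/big_rec: _ => [|i x lei [-> | [Dx lex]]]; first by left.
    by rewrite maxn0; right; split=> //; exists (val i).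
  by right; rewrite /maxn; case: ifP => _; split=> //; exists (val i).
Qed.

End MinMax.

(** Minimality is tested against removal of a single element only. Applied to sets of columns, it
    yields for each column a pair of rows, or a row, that witnesses its necessity. *)
Lemma fset_minimal (K : choiceType) (P : {fset K} -> Prop) (D : {fset K}) :
  P D -> exists D' : {fset K},
    [/\ (D' `<=` D)%fset, P D' & forall a, a \in D' -> ~ P (D' `\ a)%fset].
Proof.
have [n] := ubnP #|` D|; elim: n D => // n IH D leD PD.
have [[a aD Pa]|noP] := pselect (exists2 a, a \in D & P (D `\ a)%fset).
  have ltDa : (#|` (D `\ a)%fset| < n)%N.
    by move: leD; rewrite (cardfsD1 a) aD.
  have [D' [sub PD' min]] := IH _ ltDa Pa.
  by exists D'; split=> //; apply: fsubset_trans sub (fsubD1set _ _).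
by exists D; split=> // a aD Pa; apply: noP; exists a.
Qed.

Lemma fsubset_of_card (K : choiceType) (D : {fset K}) m :
  (m <= #|` D|)%N -> exists2 D' : {fset K}, (D' `<=` D)%fset & #|` D'| = m.
Proof.
move=> lemD; exists [fset a in take m (enum_fset D)]%fset.
  by apply/fsubsetP => a; rewrite !inE => /mem_take.
rewrite card_imfset //= undup_id; first by rewrite size_takel.
exact: take_uniq (fset_uniq D).
Qed.

(** * Cost of finite sets of attributes *)

Section Psi.
Local Open Scope nat_scope.
Local Open Scope fset_scope.
Variables (psi : seq nat -> nat) (hpsi : bounded_measure psi).
Let cm : complexity_measure psi := hpsi.1.

(** A permutation of [w'] has [w] as a prefix, so permutation invariance and monotonicity under
    appending apply. *)
Lemma psi_sub w w' : uniq w -> {subset w <= w'} -> psi w <= psi w'.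
Proof.
move=> uw sww'; suff [v pv] : exists v, perm_eq w' (w ++ v).
  by rewrite (cm_perm cm pv); apply: cm_le_cat cm _ _.
elim: w w' uw sww' => [|a w IH] w' /=; first by exists w'.
case/andP=> aw uw sww'; have aw' : a \in w' by apply: sww'; rewrite mem_head.
have [|v pv] := IH (rem a w') uw.
  move=> b bw; have := sww' b; rewrite (perm_mem (perm_to_rem aw')) !inE bw orbT.
  by case: eqP => [eb|_ /(_ isT) //]; rewrite -eb bw in aw.
by exists v; apply: perm_trans (perm_to_rem aw') _; rewrite perm_cons.
Qed.

Lemma psi_set_le_word (D : {fset nat}) w : {subset D <= w} -> psi_set psi D <= psi w.
Proof. exact: psi_sub (fset_uniq D). Qed.

Lemma psi_set_mono (D E : {fset nat}) : D `<=` E -> psi_set psi D <= psi_set psi E.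
Proof. by move/fsubsetP; apply: psi_set_le_word. Qed.

Lemma psi_setU (D E : {fset nat}) :
  psi_set psi (D `|` E) <= psi_set psi D + psi_set psi E.
Proof.
apply: leq_trans (cm_cat_le cm _ _); apply: psi_set_le_word => a.
by rewrite inE mem_cat.
Qed.

Lemma psi_set_card (D : {fset nat}) : #|` D| <= psi_set psi D.
Proof. exact: hpsi.2. Qed.

Lemma psi_set0 : psi_set psi fset0 = 0.
Proof. by apply/(cm_eq0 cm)/size0nil/cardfs0. Qed.

Lemma psi_set_bigU (X : eqType) (r : seq X) (F : X -> {fset nat}) s :
  (forall x, x \in r -> psi_set psi (F x) <= s) ->
  psi_set psi (\bigcup_(x <- r) F x) <= size r * s.
Proof.
elim: r => [|x r IH] leF; first by rewrite big_nil psi_set0.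
rewrite big_cons mulSn; apply: leq_trans (psi_setU _ _) _.
by apply: leq_add; [|apply: IH => y yr]; apply: leF; rewrite inE ?eqxx ?yr ?orbT.
Qed.

End Psi.

(** * Rows, cells and restrictions of tables *)

Section TableFacts.
Local Open Scope fset_scope.
Local Open Scope fmap_scope.
Local Open Scope nat_scope.
Variable k : nat.
Implicit Types (T : table k) (D : {fset nat}) (r : seq 'I_k).

(** Total on words, so that the decisions of one row in a table, its restrictions and its
    recolourings can be compared without membership proofs. *)
Definition decision T r : bool := odflt false (dec T).[? r].

Lemma decisionE T (r : rows T) : dec T r = decision T (val r).
Proof. by rewrite /decision (in_fnd (valP r)) /=; congr (dec T _); apply: val_inj. Qed.

Definition agrees T r (w : seq (nat * 'I_k)) : bool :=
  all (fun e => cell T r e.1 == Some e.2) w.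

Lemma decision_restrict T w r : r \in rows (restrict T w) ->
  decision (restrict T w) r = decision T r.
Proof.
move=> rTw; have : restrict T w != Lambda.
  by rewrite Lambda_rows; apply/fset0Pn; exists r.
move: (rTw); rewrite rows_restrict /decision /restrict /mk_table /insubd => /andP[rT ag].
case: insubP => [u _ e|]; last by rewrite eqxx.
rewrite /= /dec e /= => _; rewrite -/(dec T) fnd_restrict ifT //.
by rewrite !inE rT.
Qed.

Lemma mem_attrs T a : (a \in attrs T) = (a \in cols T).
Proof. by rewrite !inE. Qed.

Lemma uniq_cols T : uniq (cols T).
Proof. by case/and3P: (table_valP T). Qed.

Lemma neq_Lambda_rows T : T != Lambda -> exists r, r \in rows T.
Proof. by rewrite Lambda_rows => /fset0Pn. Qed.

Lemma rows_neq_Lambda T r : r \in rows T -> T != Lambda.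
Proof. by move=> rT; rewrite Lambda_rows; apply/fset0Pn; exists r. Qed.

Lemma attrs_neq_Lambda T a : a \in attrs T -> T != Lambda.
Proof. by rewrite mem_attrs Lambda_cols; apply: contraTneq => ->. Qed.

Lemma cell_some T r a : r \in rows T -> a \in attrs T ->
  exists i, cell T r a = Some i.
Proof.
move=> rT; rewrite mem_attrs -index_mem -(size_row rT) /cell onthE => lt.
case: r lt {rT} => // i0 r lt; exists (nth i0 (i0 :: r) (index a (cols T))).
by rewrite (nth_map i0).
Qed.

Lemma row_ext T r r' : r \in rows T -> r' \in rows T ->
  (forall a, a \in attrs T -> cell T r a = cell T r' a) -> r = r'.
Proof.
move=> rT r'T eq_cell; apply: (inj_map Some_inj).
apply: (@eq_from_nth _ None); rewrite !size_map (size_row rT) ?(size_row r'T) // => i lti.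
have := eq_cell (nth 0 (cols T) i).
by rewrite mem_attrs mem_nth // /cell index_uniq ?uniq_cols // !onthE; apply.
Qed.

(** Removes [restrict] from the definition: a path reached by no row, whose restriction is [Lambda],
    satisfies the last clause vacuously. *)
Lemma det_tree_forP T G : det_tree_for T G <->
  [/\ deterministic G, dtree_attrs G `<=` attrs T,
      forall r, r \in rows T -> exists2 p, p \in paths G & agrees T r p.1
    & forall p, p \in paths G -> forall r, r \in rows T -> agrees T r p.1 ->
        decision T r = p.2].
Proof.
split=> -[det sub cov lab]; split=> //.
- move=> r rT; have [p pG] := cov r rT; rewrite rows_restrict => /andP[_ ag].
  by exists p.
- move=> p pG r rT ag; have rTp : r \in rows (restrict T p.1).
    by rewrite rows_restrict rT.
  case: (lab p pG) => [e|]; first by rewrite e inE in rTp.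
  by move/(_ [` rTp]); rewrite decisionE decision_restrict.
- move=> r rT; have [p pG ag] := cov r rT.
  by exists p => //; rewrite rows_restrict rT.
move=> p pG; right=> -[r rTp] ; rewrite decisionE /= decision_restrict //.
by move: rTp; rewrite rows_restrict => /andP[rT ag]; apply: lab.
Qed.

Lemma onth_mask_filter (p : pred nat) (c : seq nat) r a :
  size r = size c -> p a ->
  onth (mask [seq p x | x <- c] r) (index a (filter p c)) = onth r (index a c).
Proof.
move=> sz pa; elim: c r sz => [|b c IH] [|i r] //= [sz].
have [->|neq] := eqVneq b a; first by rewrite pa /= eqxx.
by case: (p b) => /=; rewrite ?(negPf neq) /= IH.
Qed.

(** * Recolouring and projection in a closed class *)

Section Class.
Variables (A : set (table k)) (hA : closed_class A).

Lemma class_op D nu T : A T -> D `<=` attrs T -> A (J_op nu (I_op D T)).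
Proof. by move=> AT sub; rewrite -hA; exists T; split=> //; exists D, nu. Qed.

Lemma class_recolor nu T : A T -> A (J_op nu T).
Proof. by move=> AT; have := class_op nu AT (fsub0set _); rewrite I_op0. Qed.

Lemma class_Lambda T : A T -> A Lambda.
Proof.
move=> AT; have := class_op (fun=> true) AT (fsubset_refl _).
rewrite I_op_all; suff -> : J_op (fun=> true) (@Lambda k) = Lambda by [].
by apply/eqP; rewrite Lambda_cols (J_opE _ _).1.
Qed.

Lemma attrs_recolor nu T : attrs (J_op nu T) = attrs T.
Proof. by rewrite /attrs (J_opE nu T).1. Qed.

Lemma rows_recolor nu T : rows (J_op nu T) = rows T.
Proof. by rewrite /rows (J_opE nu T).2. Qed.

Lemma cell_recolor nu T r a : cell (J_op nu T) r a = cell T r a.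
Proof. by rewrite /cell (J_opE nu T).1. Qed.

Lemma decision_recolor nu T r : r \in rows T -> decision (J_op nu T) r = nu r.
Proof.
move=> rT; rewrite /decision (J_opE nu T).2.
by rewrite (@in_fnd _ _ [fmap r : rows T => nu (val r)] r rT) /= ffunE.
Qed.

(** The decisions of [T'] are left open, since they are chosen afterwards by recolouring. An empty
    [D] would give [Lambda], which loses the rows. *)
Lemma class_project T D : A T -> D `<=` attrs T -> D != fset0 ->
  exists T' (pi : seq 'I_k -> seq 'I_k),
    [/\ A T', attrs T' = D, rows T' = [fset pi r | r in rows T]
      & forall r a, r \in rows T -> a \in D -> cell T' (pi r) a = cell T r a].
Proof.
move=> AT subD D0; pose E := attrs T `\` D.
have nsub : ~~ (attrs T `<=` E).
  case/fset0Pn: D0 => a aD; apply/fsubsetPn; exists a.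
    exact: (fsubsetP subD).
  by rewrite inE aD.
have [eqc eqd] := I_opE nsub.
exists (J_op (fun=> true) (I_op E T)), (proj_row E (cols T)).
have memE a : a \in cols T -> (a \notin E) = (a \in D).
  by rewrite -mem_attrs !inE => ->; rewrite andbT negbK.
split.
- exact: class_op AT (fsubsetDl _ _).
- apply/fsetP => a; rewrite attrs_recolor mem_attrs eqc mem_filter.
  have [aT|aT] := boolP (a \in cols T); first by rewrite memE // andbT.
  by rewrite andbF; apply/esym/negP => /(fsubsetP subD); rewrite mem_attrs (negPf aT).
- by rewrite rows_recolor /rows eqd.
move=> r a rT aD; rewrite cell_recolor /cell eqc /proj_row.
apply: (onth_mask_filter (p := fun a => a \notin E)); first exact: size_row.
by rewrite memE // -mem_attrs (fsubsetP subD).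
Qed.

End Class.
End TableFacts.

(** * Decision trees: size, forced queries and construction *)

Section Trees.
Local Open Scope fset_scope.
Local Open Scope nat_scope.
Variable k : nat.
Implicit Types (T : table k) (D : {fset nat}) (r : seq 'I_k) (v : node k).

(** The subtrees in the list [es] need induction hypotheses too, which the generated principle for
    this nested type does not provide. *)
Lemma node_nested_ind (P : node k -> Prop) :
  (forall d, P (Leaf k d)) ->
  (forall f e es, P e.2 -> List.Forall (fun e' => P e'.2) es -> P (Query f e es)) ->
  forall v, P v.
Proof.
move=> PL PQ; fix IH 1; case=> [d|f e es]; [exact: PL|apply: PQ; first exact: IH].
by elim: es => [|e' es IHes]; constructor.
Qed.

Lemma node_paths_neq0 v : node_paths v != [::].
Proof. by elim/node_nested_ind: v => [//|f e es + _] /=; case: (node_paths e.2). Qed.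

Lemma path_attrs v p a : p \in node_paths v -> a \in map fst p.1 -> a \in node_attrs v.
Proof.
elim/node_nested_ind: v p => [d|f e es IHe IHes] p /=.
  by rewrite inE => /eqP ->.
rewrite mem_cat inE mem_cat => /orP[/mapP[q qe ->]|] /=.
  by rewrite inE => /orP[-> //|/(IHe _ qe) ->]; rewrite orbT.
elim: IHes => [//|e' es' IH _ IHes'] /=.
rewrite !mem_cat => /orP[/mapP[q qe ->]|pes] /=.
  by rewrite inE => /orP[-> //|/(IH _ qe) ->]; rewrite !orbT.
by move=> /(IHes' pes) /or3P[] ->; rewrite ?orbT.
Qed.

(** Determinism allows at most [k] branches. With [X = k.+1 ^ h], each branch has at most [X - 1]
    query nodes, and [1 + k (X - 1) < (k + 1) X]. *)
Lemma node_attrs_lt_expn v h : node_deterministic v ->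
  (forall p, p \in node_paths v -> size p.1 <= h) ->
  size (node_attrs v) < k.+1 ^ h.
Proof.
elim/node_nested_ind: v h => [d|f e es IHe IHes] h /=; first by rewrite expn_gt0.
case/and3P => /andP[ue ues] dete detes leh.
have [p pe] : exists p, p \in node_paths e.2.
  by case: (node_paths e.2) (node_paths_neq0 e.2) => // p; exists p; rewrite mem_head.
(* Height 0 is impossible, because a [Query] node has a path of length at least 1. *)
case: h leh => [|h] leh.
  by have := leh ((f, e.1) :: p.1, p.2); rewrite mem_cat map_f // => /(_ isT).
have lee : size (node_attrs e.2) < k.+1 ^ h.
  apply: IHe dete _ => q qe.
  by have := leh ((f, e.1) :: q.1, q.2); rewrite mem_cat map_f // => /(_ isT).
have lees : size (flatten [seq node_attrs e'.2 | e' <- es])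
              <= size es * (k.+1 ^ h).-1.
  have {}leh q :
      q \in flatten [seq [seq ((f, e'.1) :: p0.1, p0.2) | p0 <- node_paths e'.2] | e' <- es] ->
      size q.1 <= h.+1.
    by move=> qes; apply: leh; rewrite mem_cat qes orbT.
  elim: IHes detes leh {ues ue} => [//|e' es' IH _ IHes'] /= /andP[dete' detes'] leh.
  rewrite size_cat mulSn leq_add //; last first.
    by apply: IHes' => // q qes; apply: leh; rewrite mem_cat qes orbT.
  rewrite -ltnS prednK ?expn_gt0 //; apply: IH => // q qe.
  by have := leh ((f, e'.1) :: q.1, q.2); rewrite mem_cat map_f // => /(_ isT).
(* The labels of [e :: es] are distinct elements of ['I_k], and [e] takes one of them. *)
have les : size es < k.
  have := max_card (mem (e.1 :: [seq e'.1 | e' <- es])).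
  by rewrite (card_uniqP _) ?card_ord /= ?size_map // ue.
rewrite size_cat expnS; set X := k.+1 ^ h in lee lees *.
have X0 : 0 < X by rewrite expn_gt0.
have : size es * X.-1 <= k.-1 * X.-1 by rewrite leq_mul2r; apply/orP; right; lia.
by nia.
Qed.

Lemma det_treeE T G : det_tree_for T G -> exists2 v, G = Root v [::] & node_deterministic v.
Proof. by case: G => v [|v' vs] [] //= det; exists v. Qed.

Lemma paths_Root v : paths (Root v [::]) = node_paths v.
Proof. by rewrite /paths /= cats0. Qed.

Lemma dtree_attrs_Root v a : (a \in dtree_attrs (Root v [::])) = (a \in node_attrs v).
Proof. by rewrite /dtree_attrs in_fset /= cats0. Qed.

Lemma det_tree_path_attrs T G p a : det_tree_for T G -> p \in paths G ->
  a \in map fst p.1 -> a \in attrs T.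
Proof.
move=> GT; have [v eG _] := det_treeE GT; case: GT => _ sub _ _; move: sub.
rewrite eG paths_Root => /fsubsetP sub pv ap; apply: sub.
by rewrite dtree_attrs_Root; apply: path_attrs ap.
Qed.

(** If the path of [r] did not read [f], then [r'] would follow it as well and receive the same
    decision. Both lower bounds rest on this. *)
Lemma sensitive_attr_queried T G p r r' f : det_tree_for T G ->
  r \in rows T -> r' \in rows T -> decision T r != decision T r' ->
  (forall g, g \in attrs T -> g != f -> cell T r g = cell T r' g) ->
  p \in paths G -> agrees T r p.1 -> f \in map fst p.1.
Proof.
move=> GT rT r'T neq eqc pG ag; apply: contraNT neq => fp.
have /det_tree_forP[_ _ _ lab] := GT.
rewrite (lab p) // (lab p) //; apply/allP => e ep.
rewrite -eqc; first exact: (allP ag).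
  by apply: det_tree_path_attrs GT pG _; apply: map_f.
by apply: contraNneq fp => <-; apply: map_f.
Qed.

(** Branches over all values of ['I_k]; the [Leaf] is a dummy for [k = 0]. *)
Definition query f (g : 'I_k -> node k) : node k :=
  if [seq (i, g i) | i <- enum 'I_k] is e :: es then Query f e es else Leaf k true.

Lemma queryE f g : 0 < k -> exists e es,
  [/\ query f g = Query f e es & e :: es = [seq (i, g i) | i <- enum 'I_k]].
Proof.
move=> k0; rewrite /query; case E: [seq (i, g i) | i <- enum 'I_k] => [|e es].
  by move/(congr1 size): E; rewrite size_map size_enum_ord => e; rewrite e in k0.
by exists e, es.
Qed.

Lemma mem_query_paths f g p : 0 < k ->
  p \in node_paths (query f g) <->
  exists i q, q \in node_paths (g i) /\ p = ((f, i) :: q.1, q.2).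
Proof.
move=> k0; have [e [es [-> E]]] := queryE f g k0.
pose branch (e : 'I_k * node k) := [seq ((f, e.1) :: q.1, q.2) | q <- node_paths e.2].
have -> : node_paths (Query f e es) = flatten [seq branch (i, g i) | i <- enum 'I_k].
  by rewrite (map_comp branch (fun i => (i, g i))) -E.
split=> [/flatten_mapP[i _ /mapP[q qi ->]]|[i [q [qi ->]]]].
  by exists i, q.
by apply/flatten_mapP; exists i; rewrite ?mem_enum //; apply/mapP; exists q.
Qed.

Lemma query_deterministic f g : 0 < k -> (forall i, node_deterministic (g i)) ->
  node_deterministic (query f g).
Proof.
move=> k0 det; have [e [es [-> E]]] := queryE f g k0.
have -> : node_deterministic (Query f e es) =
  uniq [seq e'.1 | e' <- e :: es] && all (fun e' => node_deterministic e'.2) (e :: es) by [].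
rewrite E all_map -map_comp map_id enum_uniq.
by apply/allP => i _ /=.
Qed.

Lemma query_attrs f g a : 0 < k -> a \in node_attrs (query f g) ->
  a = f \/ exists i, a \in node_attrs (g i).
Proof.
move=> k0; have [e [es [-> E]]] := queryE f g k0.
have -> : node_attrs (Query f e es) = f :: flatten [seq node_attrs e'.2 | e' <- e :: es] by [].
rewrite E -map_comp inE => /predU1P[->|/flatten_mapP[i _ ai]]; first by left.
by right; exists i.
Qed.

(** Invariant for building a tree from the top: [C] selects the rows still compatible with the
    answers read so far, and [Q] constrains the attribute word of every path, typically its cost. *)
Definition solves T (C : pred (seq 'I_k)) (Q : seq nat -> Prop) v : Prop :=
  [/\ node_deterministic v, {subset node_attrs v <= attrs T},
      forall r, r \in rows T -> C r ->
        exists2 p, p \in node_paths v & agrees T r p.1,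
      forall p, p \in node_paths v -> forall r, r \in rows T -> C r ->
        agrees T r p.1 -> decision T r = p.2
    & forall p, p \in node_paths v -> Q (map fst p.1)].

Lemma solves_weaken T (C C' : pred (seq 'I_k)) (Q Q' : seq nat -> Prop) v :
  (forall r, C' r -> C r) -> (forall u, Q u -> Q' u) ->
  solves T C Q v -> solves T C' Q' v.
Proof.
move=> CC QQ [det sub cov lab qual]; split=> //.
- by move=> r rT /CC; apply: cov.
- by move=> p pv r rT /CC; apply: lab.
- by move=> p /qual/QQ.
Qed.

Lemma solves_leaf T (C : pred (seq 'I_k)) :
  (forall r r', r \in rows T -> r' \in rows T -> C r -> C r' ->
    decision T r = decision T r') ->
  exists v, solves T C (eq [::]) v.
Proof.
move=> const; suff [d dP] : exists d, forall r, r \in rows T -> C r -> decision T r = d.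
  exists (Leaf k d); split=> //= [r rT Cr|p|p]; rewrite ?inE.
  - by exists ([::], d); rewrite ?inE.
  - by move/eqP=> -> r rT Cr _ /=; apply: dP.
  - by move/eqP=> ->.
have [[r rT Cr]|nor] := pselect (exists2 r, r \in rows T & C r).
  by exists (decision T r) => r' r'T Cr'; apply: const.
by exists true => r rT Cr; case: nor; exists r.
Qed.

(** The induction on [w] moves each answer into [C]. A continuation is required for every tuple [e]
    of answers, even one given by no row, because [query] branches over all values. *)
Lemma solves_ask T w (C : pred (seq 'I_k)) Q : 0 < k -> {subset w <= attrs T} ->
  (forall e, size e = size w ->
    exists v, solves T (fun r => C r && agrees T r (zip w e)) Q v) ->
  exists v, solves T C (fun u => exists2 u', u = w ++ u' & Q u') v.
Proof.
move=> k0; elim: w C => [|f w IH] C subw sol.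
  have [v vP] := sol [::] erefl; exists v; apply: solves_weaken vP => [r ->|u Qu] //.
  by exists u.
have ft : f \in attrs T by apply: subw; rewrite mem_head.
have /boolp.choice[g gP] : forall i, exists v, solves T (fun r => C r && (cell T r f == Some i))
    (fun u => exists2 u', u = w ++ u' & Q u') v.
  move=> i; apply: IH => [a aw|e sz]; first by apply: subw; rewrite inE aw orbT.
  have [|v vP] := sol (i :: e); first by rewrite /= sz.
  by exists v; apply: solves_weaken vP => // r /andP[/andP[-> ci] ag]; rewrite /= ci.
exists (query f g); split.
- by apply: query_deterministic => // i; case: (gP i).
- move=> a /(query_attrs k0)[-> //|[i]].
  by case: (gP i) => _ sub _ _ _; apply: sub.
- move=> r rT Cr; have [i ci] := cell_some rT ft.
  have [_ _ cov _ _] := gP i; have [|p pg ag] := cov r rT; first by rewrite Cr ci /=.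
  exists ((f, i) :: p.1, p.2); last by rewrite /= ci eqxx.
  by apply/(mem_query_paths _ _ _ k0); exists i, p.
- move=> _ /(mem_query_paths _ _ _ k0)[i [q [qg ->]]] r rT Cr /= /andP[ci ag].
  by have [_ _ _ lab _] := gP i; apply: lab; rewrite ?Cr.
move=> _ /(mem_query_paths _ _ _ k0)[i [q [qg ->]]] /=.
by have [_ _ _ _ qual] := gP i; have [u -> Qu] := qual q qg; exists u.
Qed.

Lemma solves_tree T Q v : solves T predT Q v -> det_tree_for T (Root v [::]).
Proof.
case=> det sub cov lab _; apply/det_tree_forP; rewrite paths_Root; split=> //.
- by apply/fsubsetP => a; rewrite dtree_attrs_Root => /sub.
- by move=> r rT; apply: cov.
- by move=> p pv r rT; apply: lab.
Qed.

(** * Comparison of the complexity parameters of a table *)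

Section Complexity.
Variables (psi : seq nat -> nat) (hpsi : bounded_measure psi).

Lemma psi_tree_ge (G : dtree k) p : p \in paths G -> psi (map fst p.1) <= psi_tree psi G.
Proof.
move=> pG.
exact: (@leq_bigmax_seq _ (paths G) predT (fun p => psi (map fst p.1))).
Qed.

Lemma psid_le_tree T G : det_tree_for T G -> psid psi T <= psi_tree psi G.
Proof.
by move=> GT; rewrite /psid; case: ifP => // _; apply: minN_le; exists G.
Qed.

Lemma psid_le_solves T c v : solves T predT (fun u => psi u <= c) v -> psid psi T <= c.
Proof.
move=> sol; apply: leq_trans (psid_le_tree (solves_tree sol)) _.
rewrite /psi_tree paths_Root; apply/bigmax_leqP_seq => p pv _.
by case: sol => _ _ _ _; apply.
Qed.

(** Once all of [D] is read, the remaining rows agree on [D], hence have one decision by the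
    definition of a test. *)
Lemma test_solves T D : 0 < k -> is_test T D ->
  exists v, solves T predT (eq (enum_fset D)) v.
Proof.
move=> k0 [/fsubsetP subD tst].
have [|e sz|v vP] := @solves_ask T (enum_fset D) predT (eq [::]) k0.
- by move=> a aD; apply: subD.
- apply: solves_leaf => r r' rT r'T /= /allP ag /allP ag'.
  apply/eqP/negPn/negP => neq; have [|a aD /eqP[]] := tst [` rT] [` r'T].
    by rewrite !decisionE.
  have [i ai] : exists i, (a, i) \in zip (enum_fset D) e.
    have : a \in unzip1 (zip (enum_fset D) e) by rewrite unzip1_zip ?sz.
    by case/mapP => -[b i] bi /= ->; exists i.
  by rewrite (eqP (ag _ ai)) (eqP (ag' _ ai)).
by exists v; apply: solves_weaken vP => // u [_ -> <-]; rewrite cats0.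
Qed.

Lemma psid_le_test T D : 0 < k -> is_test T D -> psid psi T <= psi_set psi D.
Proof.
move=> k0 /(test_solves k0)[v sol]; apply: (@psid_le_solves _ _ v).
by apply: solves_weaken sol => // u <-.
Qed.

Lemma attrs_test T : is_test T (attrs T).
Proof.
split=> // r r'; rewrite !decisionE => neq.
have [//|noa] := pselect (exists2 a, a \in attrs T & cell T (val r) a != cell T (val r') a).
case/eqP: neq; congr decision; apply: (row_ext (valP r) (valP r')) => a aT.
by apply/eqP/negPn/negP => neq; apply: noa; exists a.
Qed.

Lemma Theta_test T : T != Lambda ->
  exists2 D, is_test T D & Theta psi T = psi_set psi D.
Proof.
move=> TL; rewrite /Theta (negPf TL).
have [|D tst e] := @minN_in [set m | exists2 D, is_test T D & m = psi_set psi D]%classic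
  (psi_set psi (attrs T)).
  by exists (attrs T) => //; apply: attrs_test.
by exists D.
Qed.

Lemma Theta_le_test T D : is_test T D -> Theta psi T <= psi_set psi D.
Proof. by move=> tst; rewrite /Theta; case: ifP => // _; apply: minN_le; exists D. Qed.

Lemma psid_le_Theta T : 0 < k -> psid psi T <= Theta psi T.
Proof.
move=> k0; have [->|TL] := eqVneq T Lambda; first by rewrite /psid eqxx.
by have [D tst ->] := Theta_test TL; apply: psid_le_test.
Qed.

Lemma Theta_le_W T : Theta psi T <= W psi T.
Proof.
rewrite /W; case: ifP => [/eqP ->|_]; first by rewrite /Theta eqxx.
exact/Theta_le_test/attrs_test.
Qed.

Lemma psid_tree T : 0 < k -> T != Lambda ->
  exists2 G, det_tree_for T G & psid psi T = psi_tree psi G.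
Proof.
move=> k0 TL; rewrite /psid (negPf TL).
have [v /solves_tree GT] := test_solves k0 (attrs_test T).
have [|G GT' ->] := @minN_in
  [set m | exists2 G, det_tree_for T G & m = psi_tree psi G]%classic
  (psi_tree psi (Root v [::])).
  by exists (Root v [::]).
by exists G.
Qed.

Lemma S_row_sep T r : r \in rows T ->
  exists2 D, separates T r D & S_row psi T r = psi_set psi D.
Proof.
move=> rT; suff sep : separates T r (attrs T).
  have [|D sepD e] := @minN_in
    [set m | exists2 D, separates T r D & m = psi_set psi D]%classic (psi_set psi (attrs T)).
    by exists (attrs T).
  by exists D.
split=> // r' r'T neq.
have [//|noa] := pselect (exists2 a, a \in attrs T & cell T r a != cell T r' a).
case/eqP: neq; apply: (row_ext r'T rT) => a aT.
by apply/esym/eqP/negPn/negP => neq; apply: noa; exists a.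
Qed.

Lemma S_row_le_sep T r D : separates T r D -> S_row psi T r <= psi_set psi D.
Proof. by move=> sep; apply: minN_le; exists D. Qed.

Lemma S_row_le_S_par T r : r \in rows T -> S_row psi T r <= S_par psi T.
Proof.
move=> rT; rewrite /S_par (negPf (rows_neq_Lambda rT)).
exact: (leq_bigmax [` rT]).
Qed.

Lemma separates_mem T r r' D f : separates T r D -> r' \in rows T -> r' != r ->
  (forall g, g \in attrs T -> g != f -> cell T r g = cell T r' g) -> f \in D.
Proof.
case=> subD sep r'T neq eqc; have [a aD /eqP neqa] := sep r' r'T neq.
have [<- //|naf] := eqVneq a f.
by case: neqa; apply: eqc => //; apply: (fsubsetP subD).
Qed.

(** A row that differs from [r] in [f] alone forces [f] into every set separating [r]; so every such
    set contains [D]. *)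
Lemma S_row_ge T r D : r \in rows T ->
  (forall f, f \in D -> exists r',
    [/\ r' \in rows T, r' != r
      & forall g, g \in attrs T -> g != f -> cell T r g = cell T r' g]) ->
  psi_set psi D <= S_row psi T r.
Proof.
move=> rT sens; have [E sep ->] := S_row_sep rT.
apply: psi_set_mono => //; apply/fsubsetP => f fT.
by have [r' [r'T neq eqc]] := sens f fT; apply: separates_mem sep r'T neq eqc.
Qed.

End Complexity.
End Trees.

(** Join [a f] to [b f] by an edge for each [f]. Coordinate [f] changes along this edge only, so no
    cycle can contain it; the graph is a forest and has a proper two-colouring. *)
Lemma edges_two_coloring (X : Type) (Y : eqType) (val : nat -> X -> Y)
    (a b : nat -> X) (s : seq nat) :
  uniq s -> {in s, forall f, val f (a f) != val f (b f)} ->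
  {in s &, forall f g, g != f -> val g (a f) = val g (b f)} ->
  exists nu : X -> bool, {in s, forall f, nu (a f) != nu (b f)}.
Proof.
elim: s => [|f s IH] /=; first by exists (fun=> true).
case/andP=> fs us neq eqv; have [||nu nuP] := IH us.
- by move=> g gs; apply: neq; rewrite inE gs orbT.
- by move=> g h gs hs; apply: eqv; rewrite inE ?gs ?hs orbT.
have [same|diff] := boolP (nu (a f) == nu (b f)); last first.
  by exists nu => g; rewrite inE => /predU1P[->|/nuP].
(* flipping [nu] on the class of [a f] spoils no other edge: its ends agree on [f] *)
exists (fun x => nu x (+) (val f x == val f (a f))) => g.
rewrite inE => /predU1P[->|gs].
  rewrite eqxx [val f (b f) == _]eq_sym (negPf (neq f _)) ?mem_head //.
  by rewrite (eqP same) addbF addbT; case: (nu _).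
rewrite (eqv g f) ?inE ?eqxx ?gs ?orbT //; first by rewrite (inj_eq (@addIb _)) nuP.
by apply: contraNneq fs => ->.
Qed.

(** * The functions [FW] and [FTheta], and counting rows by separating sets *)

Section Class.
Local Open Scope fset_scope.
Local Open Scope nat_scope.
Variables (k : nat) (k0 : 0 < k) (psi : seq nat -> nat) (hpsi : bounded_measure psi).
Variables (A : set (table k)) (hA0 : exists T, A T) (hA : closed_class A).
Implicit Types (T : table k) (D : {fset nat}) (r : seq 'I_k).

(** The maximum exists because [Lambda] makes the set of values nonempty and [psid <= g <= n] bounds
    it. *)
Lemma maxN_complexity g n : g Lambda = 0 -> (forall T, psid psi T <= g T) ->
  is_max (complexity_values psi A g n) (maxN (complexity_values psi A g n)).
Proof.
move=> g0 leg; apply: (@maxN_max _ 0 n) => [|_ [T [AT gn ->]]]; last first.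
  exact: leq_trans (leg T) gn.
have [T AT] := hA0; exists Lambda; rewrite g0 /psid eqxx; split=> //.
exact: class_Lambda AT.
Qed.

Lemma psid_le_W T : psid psi T <= W psi T.
Proof. exact: leq_trans (psid_le_Theta psi T k0) (Theta_le_W psi T). Qed.

Lemma FW_max n : is_max (complexity_values psi A (W psi) n) (FW psi A n).
Proof. by apply: maxN_complexity => [|T]; rewrite ?psid_le_W // /W eqxx. Qed.

Lemma FTheta_max n : is_max (complexity_values psi A (Theta psi) n) (FTheta psi A n).
Proof.
by apply: maxN_complexity => [|T]; [rewrite /Theta eqxx | apply: psid_le_Theta].
Qed.

Lemma FW_mono m n : m <= n -> FW psi A m <= FW psi A n.
Proof.
move=> lemn; have [[T [AT Wm ->]] _] := FW_max m; have [_ lub] := FW_max n.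
by apply: lub; exists T; split=> //; apply: leq_trans lemn.
Qed.

Lemma FTheta_mono m n : m <= n -> FTheta psi A m <= FTheta psi A n.
Proof.
move=> lemn; have [[T [AT Wm ->]] _] := FTheta_max m; have [_ lub] := FTheta_max n.
by apply: lub; exists T; split=> //; apply: leq_trans lemn.
Qed.

Lemma FW_le_FTheta n : FW psi A n <= FTheta psi A n.
Proof.
have [[T [AT Wm ->]] _] := FW_max n; have [_ lub] := FTheta_max n.
by apply: lub; exists T; split=> //; apply: leq_trans (Theta_le_W psi T) Wm.
Qed.

Lemma FTheta_le n : FTheta psi A n <= n.
Proof.
have [[T [AT lt ->]] _] := FTheta_max n.
exact: leq_trans (psid_le_Theta psi T k0) lt.
Qed.

Lemma psid_le_FW T n : A T -> W psi T <= n -> psid psi T <= FW psi A n.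
Proof. by move=> AT Wn; have [_ lub] := FW_max n; apply: lub; exists T. Qed.

Lemma Theta_le_rows T s : S_par psi T <= s -> Theta psi T <= nrows T * s.
Proof.
move=> leS; have /boolp.choice[F FP] : forall r : rows T, exists D,
    separates T (val r) D /\ psi_set psi D <= s.
  move=> [r rT]; have [D sep eD] := S_row_sep psi rT.
  by exists D; rewrite -eD; split=> //; apply: leq_trans (S_row_le_S_par psi rT) leS.
pose D := \bigcup_(r <- enum {: rows T}) F r.
apply: leq_trans (Theta_le_test psi (D := D) _) _; last first.
  rewrite /nrows cardfE cardE; apply: psi_set_bigU => // r _.
  by case: (FP r).
split.
  by apply/bigfcupsP => r _ _; case: (FP r) => -[].
move=> r r' neq; have [[_ sep] _] := FP r.
have [|a aF neqa] := sep (val r') (valP r').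
  by apply: contraNneq neq => /val_inj ->.
exists a => //; apply/bigfcupP; exists r => //.
by rewrite mem_enum.
Qed.

(** A row is determined by the column-value pairs on a cheapest separating set, which has at most
    [s] columns since the measure is bounded. This encodes the rows injectively by [s] pairs. *)
Lemma nrows_le_expn T s : S_par psi T <= s -> nrows T <= (#|` attrs T| * k) ^ s.
Proof.
move=> leS; have /boolp.choice[F FP] : forall r : rows T,
    exists c : {ffun 'I_s -> attrs T * 'I_k},
      (forall i, cell T (val r) (val (c i).1) = Some (c i).2) /\
      forall r', r' \in rows T ->
        (forall i, cell T r' (val (c i).1) = Some (c i).2) -> r' = val r.
  move=> [r rT] /=; have [D [subD sep] eD] := S_row_sep psi rT.
  have leD : #|` D| <= s.
    apply: leq_trans (psi_set_card hpsi D) _; rewrite -eD.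
    exact: leq_trans (S_row_le_S_par psi rT) leS.
  have [a0 a0T] : exists a, a \in attrs T.
    apply/fset0Pn; apply: contraTneq (rows_neq_Lambda rT) => /fsetP e.
    rewrite negbK Lambda_cols; case: (cols T) (fun a => mem_attrs T a) => // a c /(_ a).
    by rewrite e inE mem_head.
  (* Positions beyond the size of [D] are padded with the column [a0]. *)
  pose a (i : nat) : attrs T := insubd [` a0T] (nth a0 (enum_fset D) i).
  have /boolp.choice[v vP] : forall i : 'I_s, exists x, cell T r (val (a i)) = Some x.
    by move=> i; apply: cell_some (valP _).
  exists [ffun i : 'I_s => (a i, v i)]; split=> [i|r' r'T eqr']; first by rewrite ffunE vP.
  apply/eqP/negPn/negP => neq; have [b bD /eqP[]] := sep r' r'T neq.
  have ltb : index b (enum_fset D) < s by apply: leq_trans leD; rewrite index_mem.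
  have := eqr' (Ordinal ltb); rewrite ffunE -vP /= /a nth_index //.
  rewrite insubdK; first by move=> ->.
  exact: (fsubsetP subD).
have Finj : injective F.
  move=> r r' eF; apply: val_inj; have [eqr _] := FP r; have [_ uni] := FP r'.
  by apply: uni; [apply: valP|rewrite -eF].
by have := leq_card F Finj; rewrite card_ffun card_prod !card_ord -!cardfE.
Qed.

End Class.

(** * Logarithmic upper bound when [S_par] is bounded *)

Section UpperBound.
Local Open Scope fset_scope.
Local Open Scope nat_scope.
Variables (k : nat) (k0 : 0 < k) (psi : seq nat -> nat) (hpsi : bounded_measure psi).
Variables (A : set (table k)) (hA : closed_class A).
Variables (s : nat) (Sle : forall T, A T -> S_par psi T <= s).
Implicit Types (T : table k) (D : {fset nat}) (r : seq 'I_k).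

(* [delta] need not be a row of [T]; the hypothesis excludes the columns that
   never take the value [delta f], whose cost [S_par] does not control. *)
Lemma few_rows_agree T (delta : nat -> 'I_k) : A T -> T != Lambda ->
  (forall f, f \in attrs T -> exists2 r, r \in rows T & cell T r f = Some (delta f)) ->
  exists D, [/\ D `<=` attrs T, psi_set psi D <= 2 * s
    & forall r r', r \in rows T -> r' \in rows T ->
        (forall a, a \in D -> cell T r a = Some (delta a)) ->
        (forall a, a \in D -> cell T r' a = Some (delta a)) -> r = r'].
Proof.
move=> AT TL hit; pose on D r := forall a, a \in D -> cell T r a = Some (delta a).
have [[r0 r0T on0]|nodelta] := pselect (exists2 r, r \in rows T & on (attrs T) r).
  have [D [subD sep] eD] := S_row_sep psi r0T.
  exists D; split=> //.
    apply: (@leq_trans s); last by rewrite leq_pmull.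
    by rewrite -eD (leq_trans (S_row_le_S_par psi r0T)) ?Sle.
  suff uni r : r \in rows T -> on D r -> r = r0.
    by move=> r r' rT r'T onr onr'; rewrite (uni r) // (uni r').
  move=> rT onr; apply/eqP/negPn/negP => neq; have [a aD /eqP[]] := sep r rT neq.
  by rewrite onr // on0 // (fsubsetP subD).
pose P D := D `<=` attrs T /\ forall r, r \in rows T -> ~ on D r.
have [D [_ [subD noD] minD]] : exists D,
    [/\ D `<=` attrs T, P D & forall a, a \in D -> ~ P (D `\ a)].
  apply: fset_minimal; split=> // r rT onr; apply: nodelta; by exists r.
(* By minimality of [D], some row [w f] matches [delta] on [D] except in column [f]. *)
have /boolp.choice[w wP] : forall f, exists r, f \in D ->
    [/\ r \in rows T, on (D `\ f) r & cell T r f <> Some (delta f)].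
  move=> f; have [fD|_] := boolP (f \in D); last by exists [::].
  have [[r rT onr]|nor] := pselect (exists2 r, r \in rows T & on (D `\ f) r).
    exists r => _; split=> // rf; case: (noD r rT) => a aD.
    by have [->//|af] := eqVneq a f; apply: onr; rewrite !inE af.
  case: (minD f fD); split=> [|r rT onr]; last by apply: nor; exists r.
  exact: fsubset_trans (fsubD1set _ _) subD.
have costD f : f \in D -> psi_set psi (D `\ f) <= s.
  move=> fD; have [->|Df0] := eqVneq (D `\ f) fset0; first by rewrite psi_set0.
  have subDf : D `\ f `<=` attrs T := fsubset_trans (fsubD1set _ _) subD.
  have [T' [pi [AT' eT' eR cellpi]]] := class_project hA AT subDf Df0.
  have [wT onw _] := wP f fD.
  have wT' : pi (w f) \in rows T' by rewrite eR in_imfset.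
  apply: leq_trans (Sle AT'); apply: leq_trans (S_row_le_S_par psi wT').
  (* On the columns [D] without [f], the row of [w f] is [delta] itself, and the row of [w h]
     differs from it exactly in [h]. *)
  apply: S_row_ge => // h hDf; have hD : h \in D by move: hDf; rewrite !inE => /andP[].
  have [hT onh noh] := wP h hD; exists (pi (w h)); split.
  - by rewrite eR in_imfset.
  - by apply: contra_not_neq noh => e; rewrite -cellpi // e cellpi // onw.
  - rewrite eT' => g gDf neq; rewrite !cellpi // onw // onh //.
    by move: gDf; rewrite !inE neq => /andP[].
have [r rT] := neq_Lambda_rows TL.
have [f fD] : exists f, f \in D.
  by apply/fset0Pn/eqP => D0; apply: (noD r rT) => a; rewrite D0 inE.
have [r1 r1T r1f] := hit f (fsubsetP subD f fD).
(* The row [r1] matches [delta] in [f] but not on all of [D], so [D] has a second column [g]. Then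
   [D] is the union of two sets of cost at most [s]. *)
have [g gD r1g] : exists2 g, g \in D & cell T r1 g <> Some (delta g).
  apply/not_exists2P => all_on; apply: (noD r1 r1T) => a aD.
  by case: (all_on a) => // /contrapT.
have neq : g != f by apply: contra_not_neq r1g => ->.
exists D; split=> //; last by move=> r2 r2' r2T _ onr2; case: (noD r2 r2T).
have -> : D = (D `\ f) `|` (D `\ g).
  apply/fsetP => a; rewrite !inE; case: (a \in D); rewrite ?andbF // !andbT.
  by have [->|//] := eqVneq a f; rewrite eq_sym neq.
by rewrite (leq_trans (psi_setU hpsi _ _)) // mul2n -addnn leq_add ?costD.
Qed.

(** Take [i] most frequent in column [f]. The rows with value [j] are no more numerous than those
    with value [i] and disjoint from them, so they are at most half of [C]. *)
Lemma majority_value T (C : {fset seq 'I_k}) f : C `<=` rows T -> C != fset0 ->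
  f \in attrs T -> exists i : 'I_k,
    (exists2 r, r \in C & cell T r f = Some i) /\
    forall j, j != i -> 2 * #|` [fset r in C | cell T r f == Some j]| <= #|` C|.
Proof.
move=> subC /fset0Pn[r rC] fT.
have [i0 ri0] := cell_some (fsubsetP subC r rC) fT.
pose V j := [fset r in C | cell T r f == Some j].
have [i _ maxi] := @arg_maxnP _ i0 predT (fun j => #|` V j|) isT.
exists i; split.
  have : V i != fset0.
    rewrite -cardfs_gt0; apply: leq_trans (maxi i0 isT).
    by rewrite cardfs_gt0; apply/fset0Pn; exists r; rewrite !inE rC ri0 /=.
  by case/fset0Pn => r'; rewrite !inE => /andP[r'C /eqP]; exists r'.
move=> j neq; rewrite mul2n -addnn; apply: (@leq_trans (#|` V i| + #|` V j|)).
  by rewrite leq_add2r; apply: maxi.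
have disj : V i `&` V j = fset0.
  apply/fsetP => r'; rewrite !inE; apply/negP => /andP[/andP[_ /eqP ->] /andP[_]].
  by move=> /eqP[e]; rewrite e eqxx in neq.
rewrite -cardfsUI disj cardfs0 addn0; apply: fsubset_leq_card.
by apply/fsubsetP => r'; rewrite !inE => /orP[]/andP[].
Qed.

(* A round reads a set [D] given by [few_rows_agree] for the tuple of majority
   values of the remaining rows [C]; any other answer halves [C]. *)
Lemma halving_solves T h (C : {fset seq 'I_k}) : A T -> T != Lambda ->
  C `<=` rows T -> #|` C| <= 2 ^ h ->
  exists v, solves T (mem C) (fun u => psi u <= 2 * s * h) v.
Proof.
move=> AT TL; elim: h C => [|h IH] C subC leC.
  have [r r' _ _ rC r'C|v vP] := @solves_leaf k T (mem C).
    congr decision; move: leC; rewrite expn0 => leC; apply/eqP/negPn/negP => neq.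
    have sub : [fset r; r'] `<=` C by apply/fsubsetP => x; rewrite !inE => /orP[]/eqP->.
    by have := leq_trans (fsubset_leq_card sub) leC; rewrite cardfs2 neq.
  exists v; apply: solves_weaken vP => // u <-.
  by rewrite ((cm_eq0 hpsi.1 [::]).2 erefl).
(* An empty [C] has no majority values attained by a row. *)
have [C0|C0] := eqVneq C fset0.
  have [|v vP] := IH C subC; first by rewrite C0 cardfs0.
  exists v; apply: solves_weaken vP => // u /leq_trans; apply.
  by rewrite leq_mul2l leqnSn orbT.
have /boolp.choice[delta deltaP] : forall f, exists i, f \in attrs T ->
    (exists2 r, r \in C & cell T r f = Some i) /\
    forall j, j != i -> 2 * #|` [fset r in C | cell T r f == Some j]| <= #|` C|.
  move=> f; have [fT|_] := boolP (f \in attrs T); last by exists (Ordinal k0).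
  by have [i iP] := majority_value subC C0 fT; exists i.
have [|D [subD costD uni]] := @few_rows_agree T delta AT TL.
  move=> f fT; have [[r rC rf] _] := deltaP f fT.
  by exists r => //; apply: (fsubsetP subC).
have [|e sz|v vP] := @solves_ask k T (enum_fset D) (mem C) (fun u => psi u <= 2 * s * h) k0.
- by move=> a aD; apply: (fsubsetP subD).
- pose Ce := [fset r in C | agrees T r (zip (enum_fset D) e)].
  have subCe : Ce `<=` C by apply/fsubsetP => r; rewrite !inE => /andP[].
  have [||v vP] := IH Ce; first exact: fsubset_trans subC.
    have [[[a i] ai neq]|alldelta] := pselect
        (exists2 x, x \in zip (enum_fset D) e & x.2 != delta x.1).
      have aD : a \in D.
        have := map_f fst ai; rewrite [map fst _]unzip1_zip ?sz //.
      have [_ /(_ i neq) le2] := deltaP a (fsubsetP subD a aD).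
      suff : #|` Ce| <= #|` [fset r in C | cell T r a == Some i]|.
        by move: leC; rewrite expnS; lia.
      apply: fsubset_leq_card; apply/fsubsetP => r; rewrite !inE => /andP[-> ag].
      exact: (allP ag (a, i)).
    suff : #|` Ce| <= 1 by move=> /leq_trans; apply; rewrite expn_gt0.
    have onD r : r \in Ce -> forall a, a \in D -> cell T r a = Some (delta a).
      rewrite !inE => /andP[_ /allP ag] a aD.
      have : a \in unzip1 (zip (enum_fset D) e) by rewrite unzip1_zip ?sz.
      case/mapP => -[b i] bi /= ->; rewrite (eqP (ag _ bi)) /=.
      by congr Some; apply/eqP/negPn/negP => neq; apply: alldelta; exists (b, i).
    have [->|/fset0Pn[r rCe]] := eqVneq Ce fset0; first by rewrite cardfs0.
    rewrite -(cardfs1 r); apply: fsubset_leq_card; apply/fsubsetP => r' r'Ce.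
    have sub := fsubset_trans subCe subC; rewrite inE; apply/eqP.
    by apply: uni; rewrite ?(fsubsetP sub) //; apply: onD.
  by exists v; apply: solves_weaken vP => // r; rewrite !inE.
exists v; apply: solves_weaken vP => // u [u' -> le'].
rewrite (leq_trans (cm_cat_le hpsi.1 _ _)) // mulnS leq_add //.
Qed.

Lemma psid_le_log_nrows T h : A T -> nrows T <= 2 ^ h -> psid psi T <= 2 * s * h.
Proof.
move=> AT leN; have [->|TL] := eqVneq T Lambda; first by rewrite /psid eqxx.
have [v vP] := halving_solves AT TL (fsubset_refl _) leN.
suff : solves T predT (fun u => psi u <= 2 * s * h) v by apply: psid_le_solves.
by case: vP => det sub cov lab cost; split=> // [r rT _|p pv r rT _]; [apply: cov|apply: lab].
Qed.

(** Because [D] is a test, the decision of a row depends only on its projection to [D]. Colouring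
    the projection accordingly makes each tree for [T'] a tree for [T]. *)
Lemma project_test T D : A T -> is_test T D -> D != fset0 ->
  exists T', [/\ A T', attrs T' = D & psid psi T <= psid psi T'].
Proof.
move=> AT [subD tst] D0; have [T1 [pi [AT1 eT1 eR cellpi]]] := class_project hA AT subD D0.
pose nu r' := [exists r : rows T, (pi (val r) == r') && decision T (val r)].
have nuE r : r \in rows T -> nu (pi r) = decision T r.
  move=> rT; apply/existsP/idP => [[r' /andP[/eqP epi]]|dr]; last first.
    by exists [` rT]; rewrite /= eqxx.
  have [-> //|neq] := eqVneq (decision T r) (decision T (val r')).
  have [|a aD /eqP[]] := tst [` rT] r'; first by rewrite !decisionE.
  by rewrite -cellpi //= -epi cellpi ?(valP r').
pose T' := J_op nu T1; have AT' : A T' by apply: class_recolor.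
exists T'; split=> //; first by rewrite attrs_recolor.
have T'L : T' != Lambda.
  by case/fset0Pn: D0 => a aD; apply: (attrs_neq_Lambda (a := a)); rewrite attrs_recolor eT1.
have [G GT' ->] := psid_tree psi k0 T'L; apply: psid_le_tree.
have pathD p a : p \in paths G -> a \in map fst p.1 -> a \in D.
  by move=> pG ap; rewrite -eT1 -(attrs_recolor nu); apply: det_tree_path_attrs GT' pG ap.
have agE p r : p \in paths G -> r \in rows T -> agrees T' (pi r) p.1 = agrees T r p.1.
  move=> pG rT; apply: eq_in_all => e ep; rewrite cell_recolor cellpi //.
  by apply: pathD pG _; apply: map_f.
have piT r : r \in rows T -> pi r \in rows T1 by move=> rT; rewrite eR in_imfset.
have /det_tree_forP[det sub cov lab] := GT'; apply/det_tree_forP; split=> //.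
- by apply: fsubset_trans sub _; rewrite attrs_recolor eT1.
- move=> r rT; have [|p pG ag] := cov (pi r); first by rewrite rows_recolor piT.
  by exists p; rewrite -?agE.
- move=> p pG r rT; rewrite -agE // -nuE // -(decision_recolor nu (piT r rT)).
  by apply: lab; rewrite ?rows_recolor ?piT.
Qed.

Lemma psid_le_log_Theta T n : A T -> Theta psi T <= n ->
  psid psi T <= 2 * s * (s * up_log 2 (n * k)).
Proof.
move=> AT len; have [->|TL] := eqVneq T Lambda; first by rewrite /psid eqxx.
have [D tst eD] := Theta_test psi TL.
(* With an empty test, [Theta] and hence [psid] vanish, and no projection is available. *)
have [D0|D0] := eqVneq D fset0.
  by rewrite (leq_trans (psid_le_Theta psi T k0)) // eD D0 psi_set0.
have [T' [AT' eT' le]] := project_test AT tst D0.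
apply: leq_trans le _; apply: psid_le_log_nrows => //.
apply: leq_trans (nrows_le_expn hpsi (Sle AT')) _.
rewrite [s * _]mulnC expnM; have [s0|s0] := posnP s; first by rewrite s0 !expn0.
rewrite leq_exp2r //.
apply: leq_trans (up_logP _ _) => //; rewrite leq_mul2r eT'.
by rewrite (leq_trans (psi_set_card hpsi D)) ?orbT // -eD.
Qed.

End UpperBound.

(** * Lower bounds from sensitive columns and expensive rows *)

Section LowerBounds.
Local Open Scope fset_scope.
Local Open Scope nat_scope.
Variables (k : nat) (k0 : 0 < k) (psi : seq nat -> nat) (hpsi : bounded_measure psi).
Variables (A : set (table k)) (hA0 : exists T, A T) (hA : closed_class A).
Implicit Types (T : table k) (D : {fset nat}) (r : seq 'I_k).

Lemma nrows_le_expn_separating T D : D `<=` attrs T ->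
  {in rows T &, forall r r', (forall a, a \in D -> cell T r a = cell T r' a) -> r = r'} ->
  nrows T <= k ^ #|` D|.
Proof.
move=> /fsubsetP subD inj.
have /boolp.choice[F FP] : forall r : rows T, exists c : {ffun D -> 'I_k},
    forall a, cell T (val r) (val a) = Some (c a).
  move=> [r rT]; have /boolp.choice[c cP] : forall a : D, exists i, cell T r (val a) = Some i.
    by move=> a; apply: cell_some rT (subD _ (valP a)).
  by exists [ffun a => c a] => a; rewrite ffunE cP.
have Finj : injective F.
  move=> r r' e; apply/val_inj/inj; rewrite ?(valP r) ?(valP r') // => a aD.
  by rewrite (FP r [` aD]) (FP r' [` aD]) e.
by have := leq_card F Finj; rewrite card_ffun card_ord -!cardfE.
Qed.

(** In a table with more than [k ^ m] rows, a minimal set of columns distinguishing all rows has at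
    least [m] elements. Dropping [f] from it identifies two rows, which therefore differ in [f]
    only; such pairs survive passage to a subset of size [m]. *)
Lemma sensitive_columns m : ~ bounded_on A (@nrows k) ->
  exists T D, [/\ A T, D `<=` attrs T, #|` D| = m
    & forall f, f \in D -> exists r r', [/\ r \in rows T, r' \in rows T,
        cell T r f != cell T r' f
      & forall g, g \in D -> g != f -> cell T r g = cell T r' g]].
Proof.
move=> unb; have [T AT ltN] : exists2 T, A T & k ^ m < nrows T.
  apply: contrapT => noT; apply: unb; exists (k ^ m) => T AT.
  by rewrite leqNgt; apply/negP => lt; apply: noT; exists T.
pose P D := D `<=` attrs T /\
  {in rows T &, forall r r', (forall a, a \in D -> cell T r a = cell T r' a) -> r = r'}.
have [|D [_ [subD injD] minD]] := @fset_minimal _ P (attrs T).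
  by split=> // r r' rT r'T; apply: row_ext.
have leD : m <= #|` D|.
  rewrite leqNgt; apply/negP => ltD.
  have := leq_trans ltN (nrows_le_expn_separating subD injD).
  by rewrite ltnNge leq_pexp2l // ltnW.
have [D' subD' eD'] := fsubset_of_card leD.
exists T, D'; split=> //; first exact: fsubset_trans subD.
move=> f /(fsubsetP subD') fD; apply: contrapT => nopair; apply: (minD f fD).
split=> [|r r' rT r'T eqc]; first exact: fsubset_trans (fsubD1set _ _) subD.
apply: injD => // a aD; have [->|neq] := eqVneq a f; last first.
  by apply: eqc; rewrite !inE neq.
apply/eqP/negPn/negP => neqf; apply: nopair; exists r, r'; split=> // g gD' neq.
by apply: eqc; rewrite !inE neq (fsubsetP subD').
Qed.

(** Every column must label a node of the tree, whose depth is at most its cost since the measure is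
    bounded; the node count then gives the inequality. *)
Lemma many_columns_tree T G m : det_tree_for T G -> m = #|` attrs T| ->
  (forall f, f \in attrs T -> exists r r', [/\ r \in rows T, r' \in rows T,
      decision T r != decision T r'
    & forall g, g \in attrs T -> g != f -> cell T r g = cell T r' g]) ->
  m < k.+1 ^ psi_tree psi G.
Proof.
move=> GT -> sens; have [v eG det] := det_treeE GT.
apply: (@leq_ltn_trans (size (node_attrs v))); last first.
  apply: node_attrs_lt_expn => // p pv; rewrite -(size_map fst).
  by apply: leq_trans (hpsi.2 _) (psi_tree_ge psi _); rewrite eG paths_Root.
apply: uniq_leq_size (fset_uniq _) _ => f fT; have [r [r' [rT r'T neq eqc]]] := sens f fT.
have /det_tree_forP[_ _ cov _] := GT; have [p pG ag] := cov r rT.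
have := sensitive_attr_queried GT rT r'T neq eqc pG ag; apply: path_attrs.
by move: pG; rewrite eG paths_Root.
Qed.

Lemma exists_table_log m s : (forall T, A T -> S_par psi T <= s) ->
  ~ bounded_on A (@nrows k) ->
  exists T, [/\ A T, W psi T <= m * s & m < k.+1 ^ psid psi T].
Proof.
move=> Sle unb; have [m0|m0] := posnP m.
  have [T AT] := hA0; exists Lambda; rewrite m0 /W eqxx expn_gt0; split=> //.
  exact: class_Lambda AT.
have [T [D [AT subD eD sens]]] := sensitive_columns m unb.
have D0 : D != fset0 by rewrite -cardfs_gt0 eD.
have [T1 [pi [AT1 eT1 eR cellpi]]] := class_project hA AT subD D0.
have /boolp.choice[w wP] : forall f, exists w : seq 'I_k * seq 'I_k, f \in D ->
    [/\ w.1 \in rows T1, w.2 \in rows T1, cell T1 w.1 f != cell T1 w.2 f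
      & forall g, g \in D -> g != f -> cell T1 w.1 g = cell T1 w.2 g].
  move=> f; have [fD|_] := boolP (f \in D); last by exists ([::], [::]).
  have [r [r' [rT r'T neq eqc]]] := sens f fD; exists (pi r, pi r') => _ /=.
  rewrite eR !in_imfset // !cellpi //; split=> // g gD gf.
  by rewrite !cellpi // eqc.
have [||nu nuP] := @edges_two_coloring _ _ (fun f r => cell T1 r f)
  (fun f => (w f).1) (fun f => (w f).2) (enum_fset D) (fset_uniq D).
- by move=> f fD; have [] := wP f fD.
- by move=> f g fD gD gf; have [_ _ _] := wP f fD; apply.
pose T' := J_op nu T1; have AT' : A T' by exact: (class_recolor hA nu AT1).
have eT' : attrs T' = D by rewrite attrs_recolor.
have T'L : T' != Lambda.
  by case/fset0Pn: D0 => a; rewrite -eT'; apply: attrs_neq_Lambda.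
exists T'; split=> //.
  rewrite /W (negPf T'L) eT'.
  (* [D] is charged by singletons: every set separating the first row of the pair of [f] contains
     [f], so each singleton costs at most [s]. *)
  have -> : D = \bigcup_(f <- enum_fset D) [fset f].
    apply/fsetP => a; apply/idP/bigfcupP => [aD|[f /andP[fD _]]].
      by exists a; rewrite ?inE ?andbT.
    by rewrite inE => /eqP ->.
  rewrite -eD; apply: psi_set_bigU => // f fD; have [w1 w2 neq eqc] := wP f fD.
  apply: leq_trans (Sle _ AT1); apply: leq_trans (S_row_le_S_par psi w1).
  apply: S_row_ge => // g; rewrite inE => /eqP ->; exists (w f).2.
  by split; rewrite ?eT1 //; apply: contraNneq neq => ->.
have [G GT ->] := psid_tree psi k0 T'L.
apply: many_columns_tree GT _ _; rewrite eT' // => f fD.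
have [w1 w2 neq eqc] := wP f fD; exists (w f).1, (w f).2.
rewrite rows_recolor !decision_recolor //; split=> //; first exact: nuP.
by move=> g gD gf; rewrite !cell_recolor eqc.
Qed.

(** Uses [m = n %/ s.+1] columns, so that [m * s <= n]; the successor also allows [s = 0]. *)
Lemma le_expn_FW s n : (forall T, A T -> S_par psi T <= s) ->
  ~ bounded_on A (@nrows k) -> n <= s.+1 * k.+1 ^ FW psi A n.
Proof.
move=> Sle unb; have [T [AT leW ltm]] := exists_table_log (n %/ s.+1) Sle unb.
have leFW : psid psi T <= FW psi A n.
  apply: psid_le_FW => //; apply: leq_trans leW _.
  by apply: leq_trans (leq_divM n s.+1); rewrite leq_mul2l leqnSn orbT.
have : n < s.+1 * (n %/ s.+1).+1 by rewrite mulnC ltn_ceil.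
move/ltnW/leq_trans; apply; rewrite leq_mul2l; apply/orP; right.
by apply: leq_trans ltm _; rewrite leq_exp2l // ltnS.
Qed.

Lemma psid_eq_W_unbounded : ~ bounded_on A (S_par psi) ->
  forall b, exists2 n, (exists T, [/\ A T, W psi T = n & psid psi T = n]) & b < n.
Proof.
move=> unb b; have [T AT ltS] : exists2 T, A T & b < S_par psi T.
  apply: contrapT => noT; apply: unb; exists b => T AT.
  by rewrite leqNgt; apply/negP => lt; apply: noT; exists T.
have [r rT ltr] : exists2 r, r \in rows T & b < S_row psi T r.
  apply: contrapT => nor; suff : S_par psi T <= b by rewrite leqNgt ltS.
  rewrite /S_par; case: ifP => // _; apply/bigmax_leqP => r _.
  by rewrite leqNgt; apply/negP => lt; apply: nor; exists (val r); rewrite ?(valP r).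
have [D0 sep0 _] := S_row_sep psi rT.
have [D [_ [subD sepD] minD]] := fset_minimal sep0.
have ltD : b < psi_set psi D by apply: leq_trans ltr (S_row_le_sep psi _).
have Dn0 : D != fset0 by apply: contraTneq ltD => ->; rewrite psi_set0.
have [T1 [pi [AT1 eT1 eR cellpi]]] := class_project hA AT subD Dn0.
have rT1 : pi r \in rows T1 by rewrite eR in_imfset.
pose T' := J_op (fun r' => r' == pi r) T1.
have AT' : A T' by exact: (class_recolor hA _ AT1).
have eT' : attrs T' = D by rewrite attrs_recolor.
have rT' : pi r \in rows T' by rewrite rows_recolor.
have T'L := rows_neq_Lambda rT'.
have eW : W psi T' = psi_set psi D by rewrite /W (negPf T'L) eT'.
exists (psi_set psi D) => //; exists T'; split=> //.
apply/eqP; rewrite eqn_leq -{1}eW psid_le_W //=.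
have [G GT ->] := psid_tree psi k0 T'L.
have /det_tree_forP[_ _ cov _] := GT; have [p pG ag] := cov _ rT'.
(* It remains to see that the path [p] of the special row reads each column [f] of [D]. *)
apply: leq_trans (psi_tree_ge psi pG); apply: psi_set_le_word => // f fD.
(* By minimality of [D], removing [f] leaves some row [r'] unseparated from [r]; on [D] it differs
   from [r] in [f] only. *)
have [r' r'T [neq eqc]] : exists2 r', r' \in rows T & r' != r /\
    forall g, g \in D -> g != f -> cell T r g = cell T r' g.
  apply: contrapT => nor; apply: (minD f fD); split=> [|r' r'T neq].
    exact: fsubset_trans (fsubD1set _ _) subD.
  apply: contrapT => noa; apply: nor; exists r' => //; split=> // g gD gf.
  by apply/eqP/negPn/negP => neqg; apply: noa; exists g; rewrite // !inE gf.
have neqpi : pi r' != pi r.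
  have [a aD neqa] := sepD r' r'T neq.
  by apply: contraNneq neqa => e; rewrite -!cellpi // e.
apply: (sensitive_attr_queried (r' := pi r')) GT rT' _ _ _ pG ag.
- by rewrite rows_recolor eR in_imfset.
- have r'T1 : pi r' \in rows T1 by rewrite eR in_imfset.
  by rewrite (decision_recolor _ rT1) (decision_recolor _ r'T1) eqxx (negPf neqpi).
- by rewrite eT' => g gD gf; rewrite !cell_recolor !cellpi // eqc.
Qed.

End LowerBounds.

(** * Real logarithms and assembly of the theorem *)

Local Open Scope ring_scope.

Lemma ln2_gt0 (R : realType) : 0 < ln 2 :> R.
Proof. by apply: ln_gt0; rewrite ltr1n. Qed.

Lemma log2_ge0 (R : realType) (n : nat) : 0 <= log2 n%:R :> R.
Proof.
case: n => [|n]; first by rewrite /log2 ln0 // mul0r.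
by apply: divr_ge0; [apply: ln_ge0; rewrite ler1n | apply/ltW/ln2_gt0].
Qed.

(** The rounded-up logarithm exceeds the real one by less than 1, as
    [2 ^ (up_log 2 (n * k)).-1 < n * k]. *)
Lemma up_log2_le_log2 (R : realType) (n k : nat) : (0 < n)%N -> (1 < k)%N ->
  (up_log 2 (n * k))%:R <= log2 n%:R + (log2 k%:R + 1) :> R.
Proof.
move=> n0 k1; have nk1 : (1 < n * k)%N by rewrite (leq_trans k1) // leq_pmull.
have up0 : (0 < up_log 2 (n * k))%N by rewrite up_log_gt0.
rewrite -(prednK up0) -[X in X%:R]addn1 natrD addrA lerD2r /log2 -mulrDl ler_pdivlMr ?ln2_gt0 //.
have posnk : (n%:R : R) \is Num.pos /\ (k%:R : R) \is Num.pos.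
  by rewrite !posrE !ltr0n n0 ltnW.
rewrite -lnM ?posnk.1 ?posnk.2 // -natrM mulrC mulr_natr -lnXn ?ltr0n //.
rewrite ler_ln ?posrE ?exprn_gt0 ?ltr0n ?(ltnW nk1) // -natrX ler_nat.
by rewrite ltnW // up_log_gtn.
Qed.

(** Takes logarithms in the bound on [n] and solves for [F]; the factor [ln 2 / ln k.+1%:R] changes
    the base to [k + 1]. *)
Lemma log2_le_exponent (R : realType) (s k n F : nat) : (0 < k)%N -> (0 < n)%N ->
  (n <= s.+1 * k.+1 ^ F)%N ->
  ln 2 / ln k.+1%:R * log2 n%:R - (ln s.+1%:R / ln k.+1%:R + 1) <= F%:R :> R.
Proof.
move=> k0 n0 le; have lnk : 0 < ln k.+1%:R :> R by apply: ln_gt0; rewrite ltr1n.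
have lnn : ln n%:R <= ln s.+1%:R + F%:R * ln k.+1%:R :> R.
  rewrite mulrC mulr_natr -lnXn ?ltr0n // -lnM ?posrE ?exprn_gt0 ?ltr0n //.
  by rewrite ler_ln ?posrE ?mulr_gt0 ?exprn_gt0 ?ltr0n // -natrX -natrM ler_nat.
have -> : ln 2 / ln k.+1%:R * log2 n%:R = ln n%:R / ln k.+1%:R :> R.
  by rewrite /log2 mulrC mulrA mulfVK // gt_eqF // ln2_gt0.
rewrite opprD addrA -mulrBl lerBlDr ler_wpDr // ler_pdivrMr // lerBlDr.
by rewrite addrC.
Qed.

Theorem theorem1 (R : realType) (k : nat) (hk : (2 <= k)%N)
    (psi : seq nat -> nat) (hpsi : bounded_measure psi)
    (A : set (table k)) (hA0 : exists T, A T) (hA : closed_class A) :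
  [/\ (* F^W and F^Theta are well-defined nondecreasing functions *)
      [/\ forall n, is_max (complexity_values psi A (W psi) n) (FW psi A n),
          forall n, is_max (complexity_values psi A (Theta psi) n) (FTheta psi A n),
          forall m n, (m <= n)%N -> (FW psi A m <= FW psi A n)%N
        & forall m n, (m <= n)%N -> (FTheta psi A m <= FTheta psi A n)%N],
      (* (a) *)
      bounded_on A (S_par psi) -> bounded_on A (@nrows k) ->
        exists2 c0 : R, 0 <= c0 &
          forall n, (FW psi A n <= FTheta psi A n)%N /\ (FTheta psi A n)%:R <= c0,
      (* (b) *)
      bounded_on A (S_par psi) -> ~ bounded_on A (@nrows k) ->
        [/\ FW psi A 0 = 0%N, FTheta psi A 0 = 0%N
          & exists c1 c2 c3 c4 : R,
              [/\ 0 < c1, 0 < c2, 0 < c3, 0 < c4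
                & forall n, (0 < n)%N ->
                    [/\ c1 * log2 n%:R - c2 <= (FW psi A n)%:R,
                        (FW psi A n <= FTheta psi A n)%N
                      & (FTheta psi A n)%:R <= c3 * log2 n%:R + c4]]]
    & (* (c) *)
      ~ bounded_on A (S_par psi) ->
        exists (D : set nat) (H : nat -> nat),
          [/\ infinite_set D, is_step_function D H
            & forall n, (H n <= FW psi A n <= FTheta psi A n)%N
                        /\ (FTheta psi A n <= n)%N]].
Proof.
have k0 : (0 < k)%N by apply: ltnW.
split.
- by split=> [n|n|m n|m n]; [apply: FW_max|apply: FTheta_max|apply: FW_mono|apply: FTheta_mono].
- move=> [s Sle] [b Nle]; exists (b * s)%:R => // n.
  split; first exact: FW_le_FTheta.
  rewrite ler_nat; have [[T [AT _ ->]] _] := FTheta_max k0 psi hA0 hA n.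
  apply: leq_trans (psid_le_Theta psi T k0) _.
  by apply: leq_trans (Theta_le_rows hpsi (Sle T AT)) _; rewrite leq_mul2r Nle ?orbT.
- move=> [s Sle] Nunb.
  have FT0 : FTheta psi A 0 = 0%N by apply/eqP; rewrite -leqn0 FTheta_le.
  split=> //; first by have := FW_le_FTheta k0 psi hA0 hA 0; rewrite FT0 leqn0 => /eqP.
  have upper n : (FTheta psi A n <= 2 * s * s * up_log 2 (n * k))%N.
    have [[T [AT le ->]] _] := FTheta_max k0 psi hA0 hA n.
    by rewrite -mulnA; exact: (psid_le_log_Theta k0 hpsi hA Sle AT le).
  (* The added 1 in the last three constants keeps them positive when [s = 0]. *)
  exists (ln 2 / ln k.+1%:R), (ln s.+1%:R / ln k.+1%:R + 1),
    ((2 * s * s)%:R + 1), ((2 * s * s)%:R * (log2 k%:R + 1) + 1).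
  have lnk : 0 < ln k.+1%:R :> R by apply: ln_gt0; rewrite ltr1n.
  split.
  - by rewrite divr_gt0 ?ln2_gt0.
  - by rewrite ltr_wpDl // divr_ge0 ?(ltW lnk) // ln_ge0 // ler1n.
  - by rewrite ltr_wpDl.
  - by rewrite ltr_wpDl // mulr_ge0 // addr_ge0 ?log2_ge0.
  move=> n n0; split; last 1 first.
  - apply: (@le_trans _ _ ((2 * s * s)%:R * (up_log 2 (n * k))%:R)).
      by rewrite -natrM ler_nat.
    apply: (@le_trans _ _ ((2 * s * s)%:R * (log2 n%:R + (log2 k%:R + 1)))).
      by apply: ler_wpM2l; rewrite // up_log2_le_log2.
    by rewrite mulrDr mulrDl mul1r -addrA lerD2l addrCA lerDl addr_ge0 ?log2_ge0.
  - by apply: log2_le_exponent => //; apply: le_expn_FW.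
  - exact: FW_le_FTheta.
move=> Sunb; have [D [H [infD stepH subD HD]]] :=
  step_function_exists (psid_eq_W_unbounded k0 hpsi hA Sunb).
exists D, H; split=> // n; split; last exact: FTheta_le.
(* A nonzero [H n] is both the cost of all columns and the tree cost of some table [T] of the class,
   and [H n <= n]. *)
rewrite FW_le_FTheta // andbT; have [-> //|[/subD[T [AT eW eP]] leHn]] := HD n.
by rewrite -{1}eP; apply: (psid_le_FW k0 hA0 hA AT); rewrite eW.
Qed.
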